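(* Let $\Omega\subset\mathbb{R}^2$ be a simply connected domain and $f:\Omega\to\mathbb{R}^3$ an immersion, and consider the $SO(3)$-connection (the ''spinning sphere connection'') on the trivial $\mathbb{R}^3$-bundle over $\Omega$ whose parallel sections $\epsilon:\Omega\to\mathbb{R}^3$ are the solutions of $$d\epsilon=2\,\epsilon\times(df\circ J).$$ Then $f(\Omega)$ has mean curvature identically $1$ if and only if this connection is flat.
   Context: $J$ is the complex structure on $\Omega$ of the metric induced by $f$, i.e. rotation by $90^\circ$ in the positive sense; in conformal coordinates $(x,y)$, $df\circ J=f_y\,dx-f_x\,dy$. The unit normal $\nu$ is chosen so that $(X,JX,\nu)$ is positively oriented, and the mean curvature $H$ is defined by $\Delta_f f=2H\nu$ ($H$ is the average of the principal curvatures), so that in conformal coordinates $H\equiv1$ means $f_{xx}+f_{yy}=2f_x\times f_y$. Geometrically: along a unit-speed curve $\gamma$ with conormal $\eta=df(J\gamma')$, parallel transport is given by $\epsilon'=2\epsilon\times\eta$, i.e. a frame attached to a sphere spinning about the conormal with angular speed $2$. Flatness of the connection means that parallel transport on $\Omega$ is path independent, i.e. for each $p\in\Omega$ and each initial value $\epsilon_0\in\mathbb{R}^3$ there is a solution $\epsilon$ on $\Omega$ with $\epsilon(p)=\epsilon_0$. *)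

(* Defs.v *)
(* MathComp / MathComp-Analysis, over an arbitrary R : realType.
   R^n is the space 'rV[R]_n of row vectors. *)
From HB Require Import structures.
From mathcomp Require Import all_boot all_order all_algebra.
From mathcomp Require Import all_classical all_reals all_analysis.

Set Implicit Arguments.
Unset Strict Implicit.
Unset Printing Implicit Defensive.

Import Order.TTheory GRing.Theory Num.Theory.
Import numFieldNormedType.Exports.

Local Open Scope classical_set_scope.
Local Open Scope ring_scope.

Section Defs.
Variable R : realType.

(* Maps on an open set [Omega] are encoded as total maps on R^2; the notions
   below only depend on their values on [Omega]. *)

Definition domain (Omega : set 'rV[R]_2) : Prop :=
  [/\ open Omega, connected Omega & Omega !=set0].

(* Every loop in [A] is homotopic in [A], with fixed base point, to the
   constant loop; the homotopy parameter is the first argument of [h]. *)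
Definition loops_contractible (A : set 'rV[R]_2) : Prop :=
  forall c : R -> 'rV[R]_2,
    {within `[0, 1], continuous c} ->
    (forall t, t \in `[0, 1] -> A (c t)) ->
    c 0 = c 1 ->
    exists h : R * R -> 'rV[R]_2,
      [/\ {within `[0, 1] `*` `[0, 1], continuous h},
          forall s t, s \in `[0, 1] -> t \in `[0, 1] -> A (h (s, t)),
          forall t, t \in `[0, 1] -> h (0, t) = c t,
          forall t, t \in `[0, 1] -> h (1, t) = c 0
        & forall s, s \in `[0, 1] -> h (s, 0) = c 0 /\ h (s, 1) = c 0].

Definition simply_connected_domain (Omega : set 'rV[R]_2) : Prop :=
  domain Omega /\ loops_contractible Omega.

Definition dot n (u v : 'rV[R]_n) : R := \sum_i u 0 i * v 0 i.

(* Indices are taken modulo 3: (u x v)_i = u_(i+1) v_(i+2) - u_(i+2) v_(i+1). *)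
Definition cross (u v : 'rV[R]_3) : 'rV[R]_3 :=
  \row_(i < 3) (u 0 (i + 1) * v 0 (i + 2) - u 0 (i + 2) * v 0 (i + 1)).

Definition partial (i : 'I_2) (u : 'rV[R]_2 -> 'rV[R]_3) :
    'rV[R]_2 -> 'rV[R]_3 :=
  'D_(delta_mx 0 i) u.

Fixpoint of_class (k : nat) (Omega : set 'rV[R]_2)
    (u : 'rV[R]_2 -> 'rV[R]_3) : Prop :=
  match k with
  | 0 => forall p, Omega p -> {for p, continuous u}
  | k'.+1 => (forall p, Omega p -> differentiable u p) /\
             forall i, of_class k' Omega (partial i u)
  end.

(* C^2 is the least regularity for which the mean curvature is defined. *)
Definition immersion (Omega : set 'rV[R]_2)
    (f : 'rV[R]_2 -> 'rV[R]_3) : Prop :=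
  of_class 2 Omega f /\ forall p, Omega p -> injective ('d f p).

Section InducedGeometry.
Variable f : 'rV[R]_2 -> 'rV[R]_3.

(* Gram matrix (E F; F G) of the metric induced by [f]. *)
Definition metric (p : 'rV[R]_2) : 'M[R]_2 :=
  \matrix_(i, j) dot (partial i f p) (partial j f p).

Definition area_density (p : 'rV[R]_2) : R := Num.sqrt (\det (metric p)).

(* Rotation by +90 degrees for [metric p]:
     J (v_0, v_1) = (- (F v_0 + G v_1), E v_0 + F v_1) / sqrt (E G - F^2). *)
Definition complex_structure (p v : 'rV[R]_2) : 'rV[R]_2 :=
  let w := v *m metric p in
  (area_density p)^-1 *: \row_(j < 2) (if j == 0 then - w 0 1 else w 0 0).

Definition unit_normal (p : 'rV[R]_2) : 'rV[R]_3 :=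
  let n := cross (partial 0 f p) (partial 1 f p) in
  (Num.sqrt (dot n n))^-1 *: n.

(* Laplace-Beltrami operator of the induced metric g,
     (det g)^(-1/2) \sum_i d_i (\sum_j (det g)^(1/2) g^(ij) d_j u),
   applied to each component of [u]. *)
Definition laplace (u : 'rV[R]_2 -> 'rV[R]_3) (p : 'rV[R]_2) : 'rV[R]_3 :=
  (area_density p)^-1 *:
    \sum_i partial i (fun q =>
      \sum_j (area_density q * invmx (metric q) i j) *: partial j u q) p.

Definition has_mean_curvature (Omega : set 'rV[R]_2) (H : 'rV[R]_2 -> R) :
    Prop :=
  forall p, Omega p -> laplace f p = (2 * H p) *: unit_normal p.

(* [eps] solves d eps = 2 eps x (df o J) on [Omega]. *)
Definition parallel_section (Omega : set 'rV[R]_2)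
    (eps : 'rV[R]_2 -> 'rV[R]_3) : Prop :=
  forall p, Omega p ->
    differentiable eps p /\
    forall v, 'd eps p v =
              2 *: cross (eps p) ('d f p (complex_structure p v)).

Definition spinning_sphere_flat (Omega : set 'rV[R]_2) : Prop :=
  forall p, Omega p -> forall eps0 : 'rV[R]_3,
    exists eps, parallel_section Omega eps /\ eps p = eps0.

End InducedGeometry.
End Defs.

(* Main.v *)
(* Write alpha = 2 df(J d_0) and beta = 2 df(J d_1), so that parallel sections
   solve d_0 eps = eps x alpha, d_1 eps = eps x beta. Since (Delta f) is the
   multiple (det g)^(-1/2) of d_1 df(J d_0) - d_0 df(J d_1), and
   df(J d_0) x df(J d_1) = d_0 f x d_1 f, mean curvature 1 means exactly
   d_1 alpha - d_0 beta = alpha x beta, the vanishing of the curvature.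

   If every initial value extends to a parallel section, equality of mixed
   second derivatives of the section and the Jacobi identity give this equation.

   Conversely, on a small ball the section is obtained by solving
   e' = e x omega(v) along the rays t |-> q + t v, omega = alpha dx + beta dy.
   For two neighbouring rays with velocities v and v + w, the deviation
   D = e_(v+w) - e_v - t e_v x omega(w) satisfies D' = D x (...) + r, where
   r = o(w) uniformly in t by the curvature equation; as the first term is
   orthogonal to D, D(1) = o(w), which is the differentiability of the section
   together with the equation. Sections are then transported along chains of
   balls; a closed chain is a polygonal loop, and subdividing a contraction of it
   into a fine grid shows that its transport is trivial. *)
From HB Require Import structures.
Require Import Defs.
From mathcomp Require Import all_boot all_order all_algebra.
From mathcomp Require Import all_classical all_reals all_analysis.
From mathcomp Require Import ring lra.
Import Order.TTheory GRing.Theory Num.Theory.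
Import numFieldNormedType.Exports.

Set Implicit Arguments.
Unset Strict Implicit.
Unset Printing Implicit Defensive.

Local Open Scope classical_set_scope.
Local Open Scope ring_scope.

(** * Vector calculus in coordinates *)

Section Vectors.
Variable R : realType.
Implicit Types u v w : 'rV[R]_3.

Lemma forall_I2 (P : 'I_2 -> Prop) : P 0 -> P 1 -> forall i, P i.
Proof.
move=> P0 P1 [[|[|//]] hi].
- by rewrite (_ : Ordinal hi = 0) //; exact: val_inj.
- by rewrite (_ : Ordinal hi = 1) //; exact: val_inj.
Qed.

Lemma row3P u v : u 0 0 = v 0 0 -> u 0 1 = v 0 1 -> u 0 2 = v 0 2 -> u = v.
Proof.
move=> h0 h1 h2; apply/rowP => -[[|[|[|//]]] hi].
- by rewrite (_ : Ordinal hi = 0) //; exact: val_inj.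
- by rewrite (_ : Ordinal hi = 1) //; exact: val_inj.
- by rewrite (_ : Ordinal hi = 2) //; exact: val_inj.
Qed.

Lemma cross0E u v : cross u v 0 0 = u 0 1 * v 0 2 - u 0 2 * v 0 1.
Proof. by rewrite mxE !add0r. Qed.

Lemma cross1E u v : cross u v 0 1 = u 0 2 * v 0 0 - u 0 0 * v 0 2.
Proof.
rewrite mxE (_ : (1 + 1 : 'I_3) = 2); last exact: val_inj.
by rewrite (_ : (1 + 2 : 'I_3) = 0) //; exact: val_inj.
Qed.

Lemma cross2E u v : cross u v 0 2 = u 0 0 * v 0 1 - u 0 1 * v 0 0.
Proof.
rewrite mxE (_ : (2 + 1 : 'I_3) = 0); last exact: val_inj.
by rewrite (_ : (2 + 2 : 'I_3) = 1) //; exact: val_inj.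
Qed.

Definition crossE := (cross0E, cross1E, cross2E).

Lemma entryD n (u v : 'rV[R]_n) i : (u + v) 0 i = u 0 i + v 0 i.
Proof. by rewrite mxE. Qed.
Lemma entryN n (u : 'rV[R]_n) i : (- u) 0 i = - u 0 i.
Proof. by rewrite mxE. Qed.
Lemma entryZ n k (u : 'rV[R]_n) i : (k *: u) 0 i = k * u 0 i.
Proof. by rewrite mxE. Qed.
Lemma entry0 n i : (0 : 'rV[R]_n) 0 i = 0.
Proof. by rewrite mxE. Qed.

Definition entryE := (entryD, entryN, entryZ, entry0, cross0E, cross1E, cross2E).

Lemma dot3E u v : dot u v = u 0 0 * v 0 0 + u 0 1 * v 0 1 + u 0 2 * v 0 2.
Proof.
rewrite /dot !big_ord_recl big_ord0 addr0 addrA.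
by congr (_ * _ + _ * _ + _ * _); congr (_ _ _); exact: val_inj.
Qed.

Lemma crossBl u v w : cross (u - v) w = cross u w - cross v w.
Proof. by apply: row3P; rewrite !entryE; ring. Qed.
Lemma crossBr u v w : cross w (u - v) = cross w u - cross w v.
Proof. by apply: row3P; rewrite !entryE; ring. Qed.
Lemma crossZr k u v : cross u (k *: v) = k *: cross u v.
Proof. by apply: row3P; rewrite !entryE; ring. Qed.
Lemma cross0l v : cross 0 v = 0.
Proof. by apply: row3P; rewrite !entryE; ring. Qed.

Lemma cross_jacobi u v w :
  cross (cross u v) w - cross (cross u w) v = cross u (cross v w).
Proof. by apply: row3P; rewrite !entryE; ring. Qed.

Lemma mxnorm_le n (u : 'rV[R]_n) e :
  0 <= e -> (forall i, `|u 0 i| <= e) -> `|u| <= e.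
Proof.
move=> e0 ue; rewrite /Num.norm/= mx_normrE; apply: bigmax_le => // -[i j] _ /=.
by rewrite (ord1 i).
Qed.

Lemma coord_le_norm n (u : 'rV[R]_n) i : `|u 0 i| <= `|u|.
Proof. by rewrite [leRHS]/Num.norm/= mx_normrE; exact: (le_bigmax _ _ (0, i)). Qed.

(** The norm of row vectors is the sup norm; each coordinate is a difference of two products, each
    at most [|u| * |v|], whence the factor 2. *)
Lemma cross_norm u v : `|cross u v| <= 2 * `|u| * `|v|.
Proof.
apply: mxnorm_le => [|i]; first by rewrite !mulr_ge0.
rewrite mxE (le_trans (ler_normB _ _))// !normrM.
rewrite -mulrA mulr_natl mulr2n lerD// ler_pM// ?coord_le_norm//.
Qed.

Lemma is_derive_coordP (V : normedModType R) n (M : V -> 'rV[R]_n) (x d : V) dM :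
  is_derive x d M dM <-> forall i, is_derive x d (fun y => M y 0 i) (dM 0 i).
Proof.
split=> [[dm <-] i|h].
  apply: DeriveDef; first exact: (derivable_mxP _ _ _).1.
  by rewrite derive_mx// mxE.
have dm : derivable M x d.
  by apply/derivable_mxP => i j; rewrite (ord1 i); case: (h j).
apply: DeriveDef => //; rewrite derive_mx//; apply/rowP => i.
by rewrite mxE; apply: derive_val.
Qed.

Lemma is_derive_add (V W : normedModType R) (f g : V -> W) (x d : V) df dg :
  is_derive x d f df -> is_derive x d g dg ->
  is_derive x d (fun y => f y + g y) (df + dg).
Proof. by move=> hf hg; exact: (is_deriveD hf hg). Qed.

Lemma is_derive_sub (V W : normedModType R) (f g : V -> W) (x d : V) df dg :
  is_derive x d f df -> is_derive x d g dg ->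
  is_derive x d (fun y => f y - g y) (df - dg).
Proof. by move=> hf hg; exact: (is_deriveB hf hg). Qed.

Lemma is_derive_addR (V : normedModType R) (f g : V -> R) (x d : V) (df dg : R) :
  is_derive x d f df -> is_derive x d g dg ->
  is_derive x d (fun y => f y + g y) (df + dg).
Proof. exact: is_derive_add. Qed.

Lemma is_derive_subR (V : normedModType R) (f g : V -> R) (x d : V) (df dg : R) :
  is_derive x d f df -> is_derive x d g dg ->
  is_derive x d (fun y => f y - g y) (df - dg).
Proof. exact: is_derive_sub. Qed.

Lemma is_derive_mul (V : normedModType R) (f g : V -> R) (x d : V) (df dg : R) :
  is_derive x d f df -> is_derive x d g dg ->
  is_derive x d (fun y => f y * g y) (df * g x + f x * dg).
Proof.
move=> hf hg; apply: (is_derive_eq (is_deriveM hf hg)).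
by rewrite /GRing.scale/=; ring.
Qed.

Lemma is_derive_scale (V : normedModType R) n (k : V -> R) (f : V -> 'rV[R]_n)
    (x d : V) (dk : R) df :
  is_derive x d k dk -> is_derive x d f df ->
  is_derive x d (fun y => k y *: f y) (dk *: f x + k x *: df).
Proof.
move=> hk /is_derive_coordP hf; apply/is_derive_coordP => i.
under eq_fun do rewrite mxE.
by apply: (is_derive_eq (is_derive_mul hk (hf i))); rewrite !mxE.
Qed.

Lemma is_derive_cross (V : normedModType R) (f g : V -> 'rV[R]_3) (x d : V) df dg :
  is_derive x d f df -> is_derive x d g dg ->
  is_derive x d (fun y => cross (f y) (g y)) (cross df (g x) + cross (f x) dg).
Proof.
move=> /is_derive_coordP hf /is_derive_coordP hg; apply/is_derive_coordP => i.
under eq_fun do rewrite mxE.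
apply: (is_derive_eq (is_derive_subR (is_derive_mul (hf _) (hg _))
  (is_derive_mul (hf _) (hg _)))).
by rewrite !mxE; ring.
Qed.

Lemma is_derive_dot (V : normedModType R) (f g : V -> 'rV[R]_3) (x d : V) df dg :
  is_derive x d f df -> is_derive x d g dg ->
  is_derive x d (fun y => dot (f y) (g y)) (dot df (g x) + dot (f x) dg).
Proof.
move=> /is_derive_coordP hf /is_derive_coordP hg.
under eq_fun do rewrite dot3E.
apply: (is_derive_eq (is_derive_addR (is_derive_addR
  (is_derive_mul (hf _) (hg _)) (is_derive_mul (hf _) (hg _)))
  (is_derive_mul (hf _) (hg _)))).
by rewrite !dot3E; ring.
Qed.

Lemma cvg_rowP n (T : Type) (F : set_system T) (FF : Filter F) (M : T -> 'rV[R]_n)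
    (l : 'rV[R]_n) :
  (M x @[x --> F] --> l) <-> forall i, (M x 0 i : R^o) @[x --> F] --> (l 0 i : R^o).
Proof.
split=> [h i|h].
  apply: (@cvg_comp _ _ _ M (fun N : 'rV[R]_n => N 0 i)); first exact: h.
  exact: coord_continuous.
apply/cvgrPdist_le => e e0.
have : \forall x \near F, forall i : 'I_n, `|l 0 i - M x 0 i| <= e.
  by apply: filter_forall => i; move/cvgrPdist_le: (h i); apply.
by apply: filterS => x hx; apply: mxnorm_le => [|i]; [exact: ltW|rewrite !mxE].
Qed.

Lemma cvg_cross (T : Type) (F : set_system T) (FF : Filter F)
    (f g : T -> 'rV[R]_3) a b :
  f x @[x --> F] --> a -> g x @[x --> F] --> b ->
  cross (f x) (g x) @[x --> F] --> cross a b.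
Proof.
move=> /cvg_rowP fa /cvg_rowP gb; apply/cvg_rowP => i.
under eq_fun do rewrite mxE.
by rewrite mxE; apply: cvgB; apply: cvgM.
Qed.

End Vectors.

(** * Picard iteration *)

Section ODE.
Variable R : realType.

(** The scalar mean value theorem applies to each coordinate, with its own intermediate point; this
    is enough for the sup norm. *)
Lemma mean_value_le n (G dG : R -> 'rV[R]_n) (a b M : R) :
  a <= b -> (forall x, a <= x <= b -> is_derive x 1 G (dG x)) ->
  (forall x, a <= x <= b -> `|dG x| <= M) -> `|G b - G a| <= M * (b - a).
Proof.
move=> ab dGE dGM.
have M0 : 0 <= M by apply: le_trans (dGM a _); rewrite ?lexx.
apply: mxnorm_le => [|i]; first by rewrite mulr_ge0// subr_ge0.
have hd (x : R) : a <= x <= b -> is_derive x 1 (fun y => G y 0 i) (dG x 0 i).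
  by move=> /dGE /is_derive_coordP.
have [||c] := @MVT_segment R (fun y => G y 0 i) (fun y => dG y 0 i) a b ab.
- by move=> x; rewrite in_itv/= => /andP[? ?]; apply: hd; rewrite !ltW.
- apply: derivable_within_continuous => x xab; apply: (@ex_derive _ _ _ _ _ _ _ (hd x _)).
  by move: xab; rewrite in_itv.
rewrite in_itv/= => cab e; rewrite !mxE e normrM (ger0_norm (_ : 0 <= b - a)) ?subr_ge0//.
by rewrite ler_wpM2r ?subr_ge0// (le_trans (coord_le_norm _ _))// dGM.
Qed.

(** Integrating from -2 puts every t in the open interval strictly inside [[-2, 2]], so the
    fundamental theorem of calculus gives a two-sided derivative there. *)
Lemma antiderivative (g : R -> R) : continuous g ->
  exists G : R -> R, forall t : R, -2 < t < 2 -> is_derive t 1 G (g t).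
Proof.
move=> cg; pose mu := @lebesgue_measure R.
exists (fun x => \int[mu]_(t in `[-2, x]) g t)%R => t /andP[t1 t2].
have ig : mu.-integrable `[-2, 2] (EFin \o g).
  apply: continuous_compact_integrable; first exact: segment_compact.
  exact: continuous_subspaceT.
have [d dE] := continuous_FTC1_closed t2 ig t1 (cg t).
by apply: DeriveDef; [exact: d|rewrite -derive1E; exact: dE].
Qed.

Lemma antiderivative_vec n (g : R -> 'rV[R]_n) : continuous g ->
  exists G : R -> 'rV[R]_n,
    G 0 = 0 /\ forall t : R, -2 < t < 2 -> is_derive t 1 G (g t).
Proof.
move=> cg.
have h i : exists G : R -> R, forall t : R, -2 < t < 2 -> is_derive t 1 G (g t 0 i).
  by apply: antiderivative => t; exact: ((cvg_rowP _ _ _).1 (cg t) i).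
have [G hG] := choice h.
exists (fun t => \row_i (G i t - G i 0)); split.
  by apply/rowP => i; rewrite !mxE subrr.
move=> t tI; apply/is_derive_coordP => i; under eq_fun do rewrite mxE.
by rewrite -[g t 0 i]subr0; exact: is_derive_subR (hG i t tI) (is_derive_cst _ _ _).
Qed.

(** For [a <= b] this is the retraction of the line onto [[a, b]]; composing with it extends a
    function from a segment to a continuous function on R. *)
Definition clamp (a b t : R) : R := Num.max a (Num.min b t).

Lemma clamp_continuous a b : continuous (clamp a b).
Proof.
move=> t; apply: continuous_max; first exact: cst_continuous.
by apply: continuous_min; [exact: cst_continuous|exact: cvg_id].
Qed.

Lemma clamp_itv a b t : a <= b -> a <= clamp a b t <= b.
Proof. by move=> ab; rewrite /clamp le_max lexx ge_max ab ge_min lexx. Qed.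

Lemma clamp_id a b t : a <= t <= b -> clamp a b t = t.
Proof. by rewrite /clamp => /andP[/max_idPr h /min_idPr ->]. Qed.

(* With [|B| <= 1/6] and time clamped to [[-3/2, 3/2]], Picard iteration is a
   contraction of ratio [2 * (3/2) * (1/6) = 1/2] for the sup norm on all of R. *)
Section Picard.
Variables (B : R -> 'rV[R]_3) (e0 : 'rV[R]_3).
Hypothesis cB : continuous B.
Hypothesis B6 : forall t, `|B t| <= 6^-1.

Let cl := clamp (- (3 / 2)) (3 / 2).

Let cl_itv t : - (3 / 2) <= cl t <= 3 / 2.
Proof. by apply: clamp_itv; lra. Qed.

Let picard_step (e : R -> 'rV[R]_3) (ce : continuous e) :
  exists G : R -> 'rV[R]_3,
    G 0 = 0 /\ forall t : R, -2 < t < 2 -> is_derive t 1 G (cross (e t) (B t)).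
Proof. by apply: antiderivative_vec => t; apply: cvg_cross; [exact: ce|exact: cB]. Qed.

(** One Picard step [e' t = e0 + \int_0^t e x B], with time clamped. It is a relation because the
    primitive [G] is only known to exist. *)
Let is_step (e e' : R -> 'rV[R]_3) := exists G : R -> 'rV[R]_3,
  [/\ G 0 = 0, forall t : R, -2 < t < 2 -> is_derive t 1 G (cross (e t) (B t)) &
   forall t, e' t = e0 + G (cl t)].

Let step_continuous e e' : is_step e e' -> continuous e'.
Proof.
move=> [G [_ dG e'E]] t; rewrite (_ : e' = fun t => e0 + G (cl t)); last exact/funext.
apply: cvgD; first exact: cvg_cst.
apply: (@continuous_comp _ _ _ cl G); first exact: clamp_continuous.
have [|d _] := dG (cl t); first by have := cl_itv t; lra.
by apply: differentiable_continuous; exact/derivable1_diffP.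
Qed.

Let primitive_le (e K : R -> 'rV[R]_3) d : K 0 = 0 ->
  (forall s : R, - (3 / 2) <= s <= 3 / 2 -> is_derive s 1 K (cross (e s) (B s))) ->
  (forall t, `|e t| <= d) -> forall t, `|K (cl t)| <= d / 2.
Proof.
move=> K0 dK ed t; have d0 : 0 <= d by apply: le_trans (ed 0).
have dKM s : `|cross (e s) (B s)| <= d / 3.
  rewrite (le_trans (cross_norm _ _))//.
  apply: (@le_trans _ _ (2 * d * 6^-1)); last by lra.
  by rewrite ler_pM// ?mulr_ge0// ler_wpM2l.
have := cl_itv t; move: (cl t) => s sI.
have [s0|s0] := leP 0 s.
- have := @mean_value_le _ K (fun s => cross (e s) (B s)) 0 s (d / 3) s0.
  rewrite K0 !subr0 => h; apply: le_trans (h _ _) _ => [x xI|x xI|].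
  + by apply: dK; lra.
  + exact: dKM.
  + nra.
- have := @mean_value_le _ K (fun s => cross (e s) (B s)) s 0 (d / 3) (ltW s0).
  rewrite K0 !sub0r normrN => h; apply: le_trans (h _ _) _ => [x xI|x xI|].
  + by apply: dK; lra.
  + exact: dKM.
  + nra.
Qed.

Let step_contract e f e' f' d : is_step e e' -> is_step f f' ->
  (forall t, `|e t - f t| <= d) -> forall t, `|e' t - f' t| <= d / 2.
Proof.
move=> [G [G0 dG e'E]] [H [H0 dH f'E]] efd t; rewrite e'E f'E opprD addrACA subrr add0r.
apply: (@primitive_le (fun s => e s - f s) (fun s => G s - H s)) => //.
  by rewrite G0 H0 subrr.
move=> s sI; rewrite crossBl; apply: is_derive_sub; [apply: dG|apply: dH]; lra.
Qed.

Lemma picard_small : exists e : R -> 'rV[R]_3,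
  e 0 = e0 /\ forall t : R, 0 <= t <= 1 -> is_derive t 1 e (cross (e t) (B t)).
Proof.
(* The iterates are bundled with their continuity, which the next primitive requires; choice then
   turns the relation into a map [F]. *)
have next (e : {e : R -> 'rV[R]_3 | continuous e}) :
    exists e' : {e : R -> 'rV[R]_3 | continuous e}, is_step (sval e) (sval e').
  case: e => e ce; have [G [G0 dG]] := picard_step ce.
  have st : is_step e (fun t => e0 + G (cl t)) by exists G.
  by exists (exist _ _ (step_continuous st)).
have [F hF] := choice next.
pose u n := sval (iter n F (exist _ _ (@cst_continuous _ _ e0))).
have uS n : is_step (u n) (u n.+1) by exact: hF.
(* The first step moves by at most [|e0| / 2]; the added 1 makes [C] positive. *)
pose C := `|e0| + 1.
have C0 : 0 < C by rewrite /C ltr_pwDr.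
have u1 n t : `|u n.+1 t - u n t| <= C / 2 ^+ n.
  elim: n t => [|n ih] t.
    have -> : u 0%N t = e0 by [].
    have [G [G0 dG uE]] := uS 0%N.
    rewrite uE expr0 divr1 addrC addKr.
    have n0 := normr_ge0 e0; rewrite (@le_trans _ _ (`|e0| / 2))//; last by rewrite /C; lra.
    by apply: (@primitive_le (u 0%N)) => // s sI; apply: dG; lra.
  by rewrite exprSr invfM mulrA; apply: step_contract (uS _) (uS _) _ _.
(* Partial sum of the geometric series of the bounds [u1] from n to n + k - 1. *)
have uk n k t : `|u (n + k)%N t - u n t| <= (2 - 2 / 2 ^+ k) * (C / 2 ^+ n).
  elim: k => [|k ih]; first by rewrite addn0 !subrr normr0 expr0 divr1 subrr mul0r.
  rewrite addnS -(subrKA (u (n + k)%N t)) (le_trans (ler_normD _ _))//.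
  apply: le_trans (lerD (u1 _ _) ih) _.
  rewrite exprD exprS; set x := 2 ^+ n; set y := 2 ^+ k.
  have x0 : 0 < x by rewrite exprn_gt0.
  have y0 : 0 < y by rewrite exprn_gt0.
  rewrite le_eqVlt; apply/orP; left; apply/eqP; field; lra.
have uk2 n m t : (n <= m)%N -> `|u m t - u n t| <= 2 * C / 2 ^+ n.
  move=> nm; rewrite -(subnKC nm) (le_trans (uk _ _ _))// -mulrA ler_wpM2r//.
    by rewrite divr_ge0// ?ltW// exprn_gt0.
  by rewrite gerBl divr_ge0// exprn_ge0.
have small eps : 0 < eps -> exists N, 2 * C / 2 ^+ N < eps.
  move=> eps0; have h : (2 * C) * 2^-1 ^+ n @[n --> \oo] --> (0 : R).
    by rewrite -[X in _ --> X](mulr0 (2 * C)); apply: cvgMr; apply: cvg_expr;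
      rewrite ger0_norm//; lra.
  move/cvgrPdist_lt: h => /(_ _ eps0)[N _ /(_ N (leqnn _))]/=.
  rewrite sub0r normrN ger0_norm ?exprVn => [h|]; first by exists N.
  by rewrite mulr_ge0// ?invr_ge0 ?exprn_ge0// mulr_ge0// ltW.
have ucvg t : cvgn (u ^~ t).
  apply/cauchy_cvgP/cauchy_exP => eps eps0; have [N hN] := small _ eps0.
  exists (u N t); exists N => // n /= Nn; rewrite -ball_normE/= distrC.
  exact: le_lt_trans (uk2 _ _ _ Nn) hN.
pose e t := limn (u ^~ t).
have eu n t : `|e t - u n t| <= 2 * C / 2 ^+ n.
  apply/ler_addgt0Pr => eps eps0.
  have : \forall m \near \oo, `|e t - u m t| < eps by apply: cvgr_dist_lt => //; exact: ucvg.
  move=> [N _ hN]; have := hN (maxn n N) (leq_maxr _ _) => /= h.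
  rewrite -(subrKA (u (maxn n N) t)) (le_trans (ler_normD _ _))// addrC.
  by rewrite lerD// ?uk2 ?leq_maxl// ltW.
have ce : continuous e.
  move=> t; apply/cvgrPdist_lt => eps eps0.
  have [|N hN] := small (eps / 3); first by rewrite divr_gt0.
  have := svalP (iter N F (exist _ _ (@cst_continuous _ _ e0))) t.
  move=> /cvgrPdist_lt /(_ (eps / 3)); rewrite -/(u N) divr_gt0// => /(_ isT).
  apply: filterS => s hs.
  rewrite -(subrKA (u N t)) (le_lt_trans (ler_normD _ _))//.
  rewrite -[X in _ + `|X|](subrKA (u N s)).
  apply: le_lt_trans (lerD (eu _ _) (ler_normD _ _)) _.
  have := eu N s; rewrite distrC; lra.
have [G [G0 dG]] := picard_step ce.
have st : is_step e (fun t => e0 + G (cl t)) by exists G.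
(* The limit is a fixed point: by contraction, both [e] and the step applied to [e] are close to
   [u N.+1]. *)
have eE t : e t = e0 + G (cl t).
  apply/eqP; rewrite -subr_eq0 -normr_le0; apply/ler_addgt0Pr => eps eps0.
  have [|N hN] := small (eps / 2); first by rewrite divr_gt0.
  rewrite add0r -(subrKA (u N.+1 t)) (le_trans (ler_normD _ _))//.
  have h1 : `|e t - u N.+1 t| <= 2 * C / 2 ^+ N.
    have := eu N.+1 t; rewrite exprSr invfM mulrA.
    have : 0 <= 2 * C / 2 ^+ N by rewrite divr_ge0 ?exprn_ge0// mulr_ge0// ltW.
    lra.
  have := step_contract (uS N) st (d := 2 * C / 2 ^+ N) _ t.
  have := le_trans (normr_ge0 _) h1.
  move=> q0 h2; apply: le_trans (lerD h1 (h2 _)) _; last by lra.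
  by move=> s; rewrite distrC.
exists e; split; first by rewrite eE /cl clamp_id ?G0 ?addr0//; lra.
move=> t tI; have ht : is_derive t 1 (fun s => e0 + G s) (cross (e t) (B t)).
  rewrite -[cross _ _]add0r; apply: is_derive_add; apply: dG; lra.
(* The clamping interval contains [[0, 1]] in its interior, so clamping is the identity near t even
   at the endpoints 0 and 1. *)
apply: near_eq_is_derive ht.
have : \forall s \near t, s \in `]-(3/2), (3/2)[.
  by apply: near_in_itvoo; rewrite in_itv/=; lra.
by apply: filterS => s; rewrite in_itv/= eE => sI; rewrite /cl clamp_id//; lra.
Qed.

End Picard.
End ODE.

(** * Differentials on the plane as linear forms *)

Lemma differentiable_linear (R : realType) (V W : normedModType R) (f : V -> W)
    (L : {linear V -> W}) z : continuous L ->
  (forall eps : R, 0 < eps ->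
    \forall w \near (0 : V), `|f (z + w) - f z - L w| <= eps * `|w|) ->
  differentiable f z /\ forall v, 'd f z v = L v.
Proof.
move=> cL h.
have fE : f \o shift z = cst (f z) + L +o_ 0 id.
  apply/eqaddoP => eps eps0; have := h _ eps0; apply: filterS => w /=.
  by rewrite -[(_ - _) w]/(f (w + z) - (f z + L w)) opprD addrA [w + z]addrC.
have dE := diff_unique cL fE.
by split; [apply/diff_locallyP; rewrite dE|move=> v; rewrite dE].
Qed.

Section LinearForms.
Variables (R : realType) (n : nat).
Implicit Types (a b : 'rV[R]_n) (v w : 'rV[R]_2).

(** The value at [v] of the vector-valued one-form a dx + b dy. *)
Definition lin2 a b v : 'rV[R]_n := v 0 0 *: a + v 0 1 *: b.

Lemma lin2_is_linear a b : linear (lin2 a b).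
Proof. by move=> k v w; rewrite /lin2 !entryE; apply/rowP => i; rewrite !mxE; ring. Qed.

HB.instance Definition _ a b :=
  GRing.isLinear.Build R 'rV[R]_2 'rV[R]_n *:%R (lin2 a b) (lin2_is_linear a b).

Lemma cvg_lin2 (T : Type) (F : set_system T) (FF : Filter F)
    (f g : T -> 'rV[R]_n) (h : T -> 'rV[R]_2) a b v :
  f x @[x --> F] --> a -> g x @[x --> F] --> b -> h x @[x --> F] --> v ->
  lin2 (f x) (g x) (h x) @[x --> F] --> lin2 a b v.
Proof.
move=> fa gb /cvg_rowP hv; apply: cvgD.
  by apply: cvgZ; [exact: (hv 0)|exact: fa].
by apply: cvgZ; [exact: (hv 1)|exact: gb].
Qed.

Lemma lin2_continuous a b : continuous (lin2 a b).
Proof.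
move=> v; apply: (@cvg_lin2 _ (nbhs v) _ (cst a) (cst b) id).
- exact: cvg_cst.
- exact: cvg_cst.
- exact: cvg_id.
Qed.

Lemma lin2Bl a b c d v : lin2 a b v - lin2 c d v = lin2 (a - c) (b - d) v.
Proof. by apply/rowP => i; rewrite !mxE; ring. Qed.

Lemma lin2_norm a b v : `|lin2 a b v| <= `|v| * (`|a| + `|b|).
Proof.
rewrite mulrDr (le_trans (ler_normD _ _))// !normrZ.
by rewrite lerD// ler_wpM2r// coord_le_norm.
Qed.

Lemma row2E v : v = v 0 0 *: delta_mx 0 0 + v 0 1 *: delta_mx 0 1.
Proof.
apply/rowP; apply: forall_I2; rewrite !mxE/=.
  by rewrite mulr1 mulr0 addr0.
by rewrite mulr1 mulr0 add0r.
Qed.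

Lemma linear2E (L : {linear 'rV[R]_2 -> 'rV[R]_n}) v :
  L v = lin2 (L (delta_mx 0 0)) (L (delta_mx 0 1)) v.
Proof. by rewrite {1}[v]row2E linearD !linearZ. Qed.

Lemma differentiable_lin2 (f : 'rV[R]_2 -> 'rV[R]_n) (z : 'rV[R]_2) a b :
  (forall eps : R, 0 < eps -> \forall w \near (0 : 'rV[R]_2),
    `|f (z + w) - f z - lin2 a b w| <= eps * `|w|) ->
  differentiable f z /\ forall v, 'd f z v = lin2 a b v.
Proof. by apply: differentiable_linear; exact: lin2_continuous. Qed.

End LinearForms.

(** * Derivatives along lines and growth of spinning vectors *)

Section Curves.
Variable R : realType.

Lemma is_derive_line (V W : normedModType R) (g : V -> W) q v (t : R) d :
  is_derive (q + t *: v) v g d -> is_derive t 1 (fun s => g (q + s *: v)) d.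
Proof.
have E : (fun h : R => h^-1 *: (((fun s => g (q + s *: v)) \o shift t) (h *: 1) - g (q + t *: v))) =
   (fun h : R => h^-1 *: ((g \o shift (q + t *: v)) (h *: v) - g (q + t *: v))).
  apply/funext => h /=; congr (_ *: (g _ - _)).
  by rewrite [h *: 1]mulr1 scalerDl addrCA.
by move=> [dg dgE]; split; rewrite ?/derivable ?/derive E.
Qed.

Lemma is_derive_line_diff (V W : normedModType R) (g : V -> W) q v (t : R) :
  differentiable g (q + t *: v) ->
  is_derive t 1 (fun s => g (q + s *: v)) ('d g (q + t *: v) v).
Proof.
move=> dg; apply: is_derive_line; apply: DeriveDef; first exact: diff_derivable.
exact: deriveE.
Qed.

(* [D x B] is orthogonal to [D], so [(2 - t)^2 (|D|^2 + 3 rho^2)] is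
   nonincreasing on [[0, 1]]. *)
Lemma spinning_norm_le (D r B : R -> 'rV[R]_3) rho : D 0 = 0 ->
  (forall t : R, 0 <= t <= 1 -> is_derive t 1 D (cross (D t) (B t) + r t)) ->
  (forall t, 0 <= t <= 1 -> `|r t| <= rho) -> `|D 1| <= 3 * rho.
Proof.
move=> D0 dD rM.
have rho0 : 0 <= rho by apply: le_trans (rM 0 _); rewrite ?lexx ?ler01.
pose g t := (2 - t) * (2 - t) * (dot (D t) (D t) + 3 * rho * rho).
have dg (t : R) : 0 <= t <= 1 -> is_derive t 1 g
    (- (2 * (2 - t)) * (dot (D t) (D t) + 3 * rho * rho) +
     (2 - t) * (2 - t) * (2 * dot (D t) (r t))).
  move=> tI; have hD := dD t tI.
  have h0 (c : R) : is_derive t 1 (fun=> c) (0 : R) by exact: is_derive_cst.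
  have h2 : is_derive t 1 (fun s => 2 - s) (-1 : R).
    by rewrite -[-1]add0r; exact: is_derive_subR (h0 2) (is_derive_id _ _).
  have hQ := is_derive_addR (is_derive_dot hD hD) (h0 (3 * rho * rho)).
  apply: (is_derive_eq (is_derive_mul (is_derive_mul h2 h2) hQ)).
  by rewrite !dot3E !entryE; ring.
have g10 : g 1 <= g 0.
  have h (t : R) : t \in `]0, 1[ -> 0 <= t <= 1.
    by rewrite in_itv/= => /andP[? ?]; rewrite !ltW.
  apply: (@ler0_derive1_le_cc R g 0 1); last 1 first.
  - exact: ler01.
  - by move=> t /h/dg [].
  - move=> t tI; rewrite derive1E (@derive_val _ _ _ _ _ _ _ (dg t (h t tI))).
    set Q := dot _ _ + _.
    have rQ : 2 * dot (D t) (r t) <= Q.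
      have rr i : r t 0 i * r t 0 i <= rho * rho.
        have := le_trans (coord_le_norm (r t) i) (rM t (h t tI)).
        by rewrite ler_norml => /andP[? ?]; nra.
      rewrite /Q !dot3E.
      have := sqr_ge0 (D t 0 0 - r t 0 0).
      have := sqr_ge0 (D t 0 1 - r t 0 1).
      have := sqr_ge0 (D t 0 2 - r t 0 2).
      by rewrite !expr2; have := rr 0; have := rr 1; have := rr 2; lra.
    have Q0 : 0 <= Q.
      rewrite /Q dot3E; have := sqr_ge0 (D t 0 0); have := sqr_ge0 (D t 0 1).
      have := sqr_ge0 (D t 0 2); have := sqr_ge0 rho; rewrite !expr2; lra.
    move: (h t tI) rQ Q0; move: Q (2 * dot _ _) => Q X /andP[t0 t1] rQ Q0.
    have h1 : (2 - t) * X <= 2 * Q by nra.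
    have h2 : (2 - t) * ((2 - t) * X) <= (2 - t) * (2 * Q) by rewrite ler_wpM2l//; lra.
    by lra.
  - apply: derivable_within_continuous => t; rewrite in_itv/= => tI.
    by apply: (@ex_derive _ _ _ _ _ _ _ (dg t _)).
  - by rewrite in_itv/= lexx ler01.
  - by rewrite in_itv/= lexx ler01.
(* The inequality [g 1 <= g 0] reads |D(1)|^2 + 3 rho^2 <= 4 (3 rho^2). *)
have DD : dot (D 1) (D 1) <= (3 * rho) * (3 * rho).
  by move: g10; rewrite /g D0 [dot 0 0]dot3E !entry0; lra.
apply: mxnorm_le => [|i]; first by rewrite mulr_ge0.
have Di : D 1 0 i * D 1 0 i <= dot (D 1) (D 1).
  by rewrite /dot (bigD1 i)//= lerDl sumr_ge0// => j _; rewrite -expr2 sqr_ge0.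
rewrite -(ler_pXn2r (n := 2))// ?nnegrE ?mulr_ge0//.
by rewrite real_normK ?num_real// !expr2; apply: le_trans DD.
Qed.

End Curves.

(* Conversion tests that unfold this limit practically never end. *)
Local Opaque partial.

(** * Strict differentiability of maps of class C^1 *)

Section C1.
Variable R : realType.

Lemma diffE_partial (g : 'rV[R]_2 -> 'rV[R]_3) z w : differentiable g z ->
  'd g z w = lin2 (partial 0 g z) (partial 1 g z) w.
Proof. by move=> dg; rewrite linear2E -!deriveE. Qed.

Lemma is_derive_line_partial (g : 'rV[R]_2 -> 'rV[R]_3) q v (t : R) :
  differentiable g (q + t *: v) ->
  is_derive t 1 (fun s => g (q + s *: v))
    (lin2 (partial 0 g (q + t *: v)) (partial 1 g (q + t *: v)) v).
Proof.
by move=> dg; apply: is_derive_eq (is_derive_line_diff dg) (diffE_partial _ dg).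
Qed.

Lemma near_norm (V : normedModType R) (z0 : V) (P : V -> Prop) :
  (\forall z \near z0, P z) ->
  exists2 r : R, 0 < r & forall z, `|z - z0| < r -> P z.
Proof.
move=> /nbhs_ballP[r r0 hr]; exists r => // z zr.
by apply: hr; rewrite -ball_normE /= distrC.
Qed.

Lemma ball_segment n (p x y : 'rV[R]_n) (r t : R) :
  0 <= t <= 1 -> ball p r x -> ball p r y -> ball p r (x + t *: (y - x)).
Proof.
rewrite -!ball_normE /= => /andP[t0 t1] px py.
have -> : p - (x + t *: (y - x)) = (1 - t) *: (p - x) + t *: (p - y).
  by apply/rowP => i; rewrite !mxE; ring.
rewrite (le_lt_trans (ler_normD _ _))// !normrZ !ger0_norm ?subr_ge0//.
have [->|tn] := eqVneq t 0; first by rewrite subr0 mul1r mul0r addr0.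
have : t * `|p - y| < t * r by rewrite ltr_pM2l// lt_neqAle eq_sym tn.
have : (1 - t) * `|p - x| <= (1 - t) * r by rewrite ler_wpM2l ?subr_ge0// ltW.
lra.
Qed.

Lemma dist_quarter (V : normedModType R) (x y z : V) (eps : R) :
  `|z - x| < eps / 4 -> `|z - y| < eps / 4 -> `|y - x| <= eps / 2.
Proof. by move=> zx zy; have := ler_distD z y x; rewrite (distrC y z); lra. Qed.

(** The estimate is uniform in the base point [z]: the partial derivatives vary little near [z0], so
    the mean value inequality applies to g(z + s w) - s L(z) on [[0, 1]], where L(z) is the value of
    the differential at w. Halving the radius keeps the whole segment in the neighbourhood. *)
Lemma of_class1_strict (Omega : set 'rV[R]_2) (g : 'rV[R]_2 -> 'rV[R]_3) z0 (eps : R) :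
  open Omega -> of_class 1 Omega g -> Omega z0 -> 0 < eps ->
  exists2 r : R, 0 < r & forall z w : 'rV[R]_2, `|z - z0| < r -> `|w| < r ->
    `|g (z + w) - g z - lin2 (partial 0 g z) (partial 1 g z) w| <= eps * `|w|.
Proof.
move=> oO [dg cg] Oz0 eps0.
have nO : \forall z \near z0, Omega z by apply: open_nbhs_nbhs.
have np i : \forall z \near z0, `|partial i g z0 - partial i g z| < eps / 4.
  by move/cvgrPdist_lt: (cg i _ Oz0); apply; rewrite divr_gt0.
have [r r0 hr] := near_norm (filterI nO (filterI (np 0) (np 1))).
exists (r / 2); first by rewrite divr_gt0.
move=> z w zr wr.
have hs s : 0 <= s <= 1 -> [/\ Omega (z + s *: w),
    `|partial 0 g z0 - partial 0 g (z + s *: w)| < eps / 4 &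
    `|partial 1 g z0 - partial 1 g (z + s *: w)| < eps / 4].
  move=> /andP[s0 s1].
  suff : `|z + s *: w - z0| < r by move=> /hr[? []].
  rewrite addrAC (le_lt_trans (ler_normD _ _))// normrZ ger0_norm//.
  have : s * `|w| <= `|w| by rewrite ler_piMl.
  lra.
have [_ p0z p1z] : [/\ Omega z, `|partial 0 g z0 - partial 0 g z| < eps / 4 &
    `|partial 1 g z0 - partial 1 g z| < eps / 4].
  by have := hs 0; rewrite scale0r addr0; apply; rewrite lexx ler01.
have Oz : Omega z by have := hs 0; rewrite scale0r addr0 lexx ler01 => /(_ isT)[].
pose L z := lin2 (partial 0 g z) (partial 1 g z) w.
pose G s := g (z + s *: w) - s *: L z.
have dG (s : R) : 0 <= s <= 1 -> is_derive s 1 G (L (z + s *: w) - L z).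
  move=> sI; apply: is_derive_sub.
    by apply: is_derive_line_partial; apply: dg; have [] := hs s sI.
  have := is_derive_scale (is_derive_id s 1) (is_derive_cst (L z) s 1).
  by rewrite scaler0 addr0 scale1r.
have -> : g (z + w) - g z - lin2 (partial 0 g z) (partial 1 g z) w = G 1 - G 0.
  by rewrite /G !scale1r !scale0r addr0 subr0 addrAC.
have := mean_value_le ler01 dG (M := eps * `|w|); rewrite subr0 mulr1; apply=> s sI.
have [Os q0 q1] := hs s sI; rewrite /L.
rewrite lin2Bl.
rewrite (le_trans (lin2_norm _ _ _))// mulrC ler_wpM2r//.
have := lerD (dist_quarter p0z q0) (dist_quarter p1z q1); rewrite -splitr; exact.
Qed.

End C1.

(** * Parallel sections on small balls *)

Section Residual.
Variable R : realType.
Implicit Types (e a b : 'rV[R]_3) (v w : 'rV[R]_2).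

Lemma cross_lin2 e a b v : cross e (lin2 a b v) = lin2 (cross e a) (cross e b) v.
Proof. by apply: row3P; rewrite /lin2 !entryE; ring. Qed.

(* [e] and [e'] are frames transported along the rays of velocities [v] and
   [v + w]; unprimed data are taken at [z] on the first ray, primed ones at
   [z + t w]. The residual is the inhomogeneous term in the equation of
   [e' - e - t e x omega(w)]. *)
Definition residual e a b a' b' A0 A1 B0 B1 v w (t : R) : 'rV[R]_3 :=
  cross e (lin2 (a' - a - t *: lin2 A0 A1 w) (b' - b - t *: lin2 B0 B1 w) (v + w))
  + t *: cross e (lin2 (lin2 A0 A1 w) (lin2 B0 B1 w) w)
  + t *: cross (cross e (lin2 a b w)) (lin2 a' b' (v + w) - lin2 a b v).

(** The curvature equation allows v and w to be exchanged in the derivative of omega, at the cost of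
    omega(v) x omega(w); the Jacobi identity then turns (e x omega(v)) x omega(w) into (e x
    omega(w)) x omega(v), which matches the last term of the residual. *)
Lemma residualE e e' a b a' b' A0 A1 B0 B1 v w (t : R) :
  A1 - B0 = cross a b ->
  cross e' (lin2 a' b' (v + w)) - cross e (lin2 a b v) -
    (1 *: cross e (lin2 a b w) + t *: (cross (cross e (lin2 a b v)) (lin2 a b w)
       + cross e (lin2 (lin2 A0 A1 v) (lin2 B0 B1 v) w)))
  = cross (e' - e - t *: cross e (lin2 a b w)) (lin2 a' b' (v + w))
    + residual e a b a' b' A0 A1 B0 B1 v w t.
Proof.
move=> /(canRL (subrK _)) ->; rewrite /residual.
pose X := lin2 (lin2 A0 (cross a b + B0) w) (lin2 B0 B1 w) v.
pose Z := lin2 (lin2 A0 (cross a b + B0) w) (lin2 B0 B1 w) w.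
rewrite -/Z.
have -> : lin2 (lin2 A0 (cross a b + B0) v) (lin2 B0 B1 v) w =
    X - cross (lin2 a b v) (lin2 a b w).
  by apply: row3P; rewrite /X /lin2 !entryE; ring.
have -> : lin2 (a' - a - t *: lin2 A0 (cross a b + B0) w) (b' - b - t *: lin2 B0 B1 w)
    (v + w) = lin2 a' b' (v + w) - (lin2 a b v + lin2 a b w) - t *: (X + Z).
  by apply/rowP => i; rewrite /X /Z /lin2 !entryE; ring.
move: (lin2 a' b' _) (lin2 a b v) (lin2 a b w) X Z => o' ov ow X Z.
by apply: row3P; rewrite !entryE; ring.
Qed.

(** The three summands of the constant bound the three terms of [residual]. The first uses the
    first-order errors of a' and b'; the other two are quadratic in w, and one factor [|w|] is
    replaced by [eps]. *)
Lemma residual_norm e a b a' b' A0 A1 B0 B1 v w (t M V eps : R) :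
  0 <= t <= 1 -> `|e| <= M -> `|a| <= M -> `|b| <= M ->
  `|A0| <= M -> `|A1| <= M -> `|B0| <= M -> `|B1| <= M ->
  `|a' - a - t *: lin2 A0 A1 w| <= eps * `|w| ->
  `|b' - b - t *: lin2 B0 B1 w| <= eps * `|w| ->
  `|v + w| <= V -> `|w| <= eps -> eps <= 1 ->
  `|residual e a b a' b' A0 A1 B0 B1 v w t| <=
  (4 * M * V + 8 * M * M + 8 * M * M * (V * (2 * (1 + 2 * M)) + 2 * M)) * eps * `|w|.
Proof.
move=> /andP[t0 t1] eM aM bM A0M A1M B0M B1M ha hb vwV weps eps1.
set n := `|w|; have n0 : 0 <= n by exact: normr_ge0.
have M0 : 0 <= M by exact: le_trans (normr_ge0 _) eM.
have V0 : 0 <= V by exact: le_trans (normr_ge0 _) vwV.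
have lin_le (x y : 'rV[R]_3) (u : 'rV[R]_2) X Y U : `|x| <= X -> `|y| <= Y -> `|u| <= U ->
    `|lin2 x y u| <= U * (X + Y).
  move=> xX yY uU; rewrite (le_trans (lin2_norm _ _ _))// ler_pM ?addr_ge0//.
  exact: lerD.
have cross_le (x y : 'rV[R]_3) X Y : `|x| <= X -> `|y| <= Y -> `|cross x y| <= 2 * X * Y.
  move=> xX yY; rewrite (le_trans (cross_norm _ _))// ler_pM ?mulr_ge0//.
  by rewrite ler_wpM2l.
have scale_le (x : 'rV[R]_3) X : `|x| <= X -> `|t *: x| <= X.
  move=> xX; rewrite normrZ ger0_norm// (le_trans _ xX)//.
  by rewrite ler_piMl.
have dA : `|lin2 A0 A1 w| <= n * (M + M) by exact: lin_le.
have dB : `|lin2 B0 B1 w| <= n * (M + M) by exact: lin_le.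
have da : `|a' - a| <= eps * n + n * (M + M).
  rewrite -(subrK (t *: lin2 A0 A1 w) (a' - a)) (le_trans (ler_normD _ _))//.
  by apply: lerD; [exact: ha|exact: scale_le].
have db : `|b' - b| <= eps * n + n * (M + M).
  rewrite -(subrK (t *: lin2 B0 B1 w) (b' - b)) (le_trans (ler_normD _ _))//.
  by apply: lerD; [exact: hb|exact: scale_le].
have d3 : `|lin2 a' b' (v + w) - lin2 a b v| <=
    V * ((eps * n + n * (M + M)) + (eps * n + n * (M + M))) + n * (M + M).
  have -> : lin2 a' b' (v + w) - lin2 a b v =
      lin2 (a' - a) (b' - b) (v + w) + lin2 a b w.
    by apply/rowP => i; rewrite !mxE; ring.
  by rewrite (le_trans (ler_normD _ _))// lerD//; exact: lin_le.
have T1 := cross_le _ _ _ _ eM (lin_le _ _ _ _ _ _ ha hb vwV).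
have T2 := scale_le _ _ (cross_le _ _ _ _ eM (lin_le _ _ _ _ _ _ dA dB (lexx n))).
have T3 := scale_le _ _ (cross_le _ _ _ _ (cross_le _ _ _ _ eM
   (lin_le _ _ _ _ _ _ aM bM (lexx n))) d3).
rewrite /residual (le_trans (ler_normD _ _))//.
apply: le_trans (lerD (le_trans (ler_normD _ _) (lerD T1 T2)) T3) _.
rewrite -/n in weps *.
have nn : n * n <= n * eps by rewrite ler_wpM2l.
have en : eps * n <= n by rewrite ler_piMl.
rewrite [leRHS](_ : _ = 4 * M * V * eps * n + 8 * M * M * eps * n +
  8 * M * M * (V * (2 * (1 + 2 * M)) + 2 * M) * eps * n); last by rewrite -!mulrDl.
apply: lerD; first apply: lerD.
- lra.
- have : M * M * (n * n) <= M * M * (n * eps) by rewrite ler_wpM2l ?mulr_ge0.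
  lra.
- have h1 : V * ((eps * n + n * (M + M)) + (eps * n + n * (M + M))) + n * (M + M) <=
    n * (V * (2 * (1 + 2 * M)) + 2 * M).
    have : V * (eps * n) <= V * n by rewrite ler_wpM2l.
    lra.
  have K0 : 0 <= M * M * (V * (2 * (1 + 2 * M)) + 2 * M).
    by rewrite mulr_ge0 ?mulr_ge0// addr_ge0 ?mulr_ge0 ?addr_ge0 ?mulr_ge0.
  have c0 : 0 <= 2 * (2 * M * (n * (M + M))) by rewrite !mulr_ge0// addr_ge0.
  apply: le_trans (ler_wpM2l c0 h1) _.
  have := ler_wpM2l K0 nn.
  lra.
Qed.

End Residual.

(** * Transport along rays and its deviation *)

Section Rays.
Variable R : realType.

Lemma line_continuous (V : normedModType R) (q v : V) :
  continuous (fun t : R => q + t *: v).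
Proof.
move=> t; apply: cvgD; first exact: cvg_cst.
by apply: cvgZr_tmp; exact: cvg_id.
Qed.

Lemma segment_bounded (g : R -> R) :
  (forall t : R, 0 <= t <= 1 -> {for t, continuous g}) ->
  exists M, forall t, 0 <= t <= 1 -> g t <= M.
Proof.
move=> cg; have [||c _ hc] := @EVT_max R g 0 1.
- exact: ler01.
- by apply: continuous_in_subspaceT => t; rewrite inE/= in_itv/= => /cg.
by exists (g c) => t tI; apply: hc; rewrite in_itv.
Qed.

(** Strict differentiability gives the estimate near each time; compactness of [[0, 1]] makes one
    neighbourhood of 0 serve for all times. *)
Lemma segment_strict (Omega : set 'rV[R]_2) (g : 'rV[R]_2 -> 'rV[R]_3) q v (eps : R) :
  open Omega -> of_class 1 Omega g -> (forall t : R, 0 <= t <= 1 -> Omega (q + t *: v)) ->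
  0 < eps -> \forall w \near (0 : 'rV[R]_2), forall t, 0 <= t <= 1 ->
    `|g (q + t *: v + t *: w) - g (q + t *: v) -
      t *: lin2 (partial 0 g (q + t *: v)) (partial 1 g (q + t *: v)) w| <= eps * `|w|.
Proof.
move=> oO g1 Oqv eps0.
pose P (w : 'rV[R]_2) (t : R) := `|g (q + t *: v + t *: w) - g (q + t *: v) -
      t *: lin2 (partial 0 g (q + t *: v)) (partial 1 g (q + t *: v)) w| <= eps * `|w|.
have cK := (near_covering_withinP _).2
  ((compact_near_coveringP _).1 (@segment_compact R 0 1)).
have : \forall w \near (0 : 'rV[R]_2), `[0, 1] `<=` P w.
  apply: (cK _ (nbhs (0 : 'rV[R]_2)) P (nbhs_filter _)) => t0; rewrite /= in_itv/= => t0I.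
  have [r r0 hr] := of_class1_strict oO g1 (Oqv _ t0I) eps0.
  have nt : \forall t \near t0, `|q + t0 *: v - (q + t *: v)| < r.
    by move/cvgrPdist_lt: (@line_continuous _ q v t0); apply.
  have nw : \forall w \near (0 : 'rV[R]_2), `|w| < r by exact: nbhs0_lt.
  exists ([set t | `|q + t0 *: v - (q + t *: v)| < r], [set w | `|w| < r]) => //.
  move=> [t w] /= [ht hw]; rewrite in_itv/= => /andP[t1 t2].
  have tw : `|t *: w| <= `|w| by rewrite normrZ ger0_norm// ler_piMl.
  have := hr (q + t *: v) (t *: w); rewrite distrC => /(_ ht (le_lt_trans tw hw)).
  rewrite [lin2 _ _ (t *: w)]linearZ => h; apply: le_trans h _.
  by rewrite ler_wpM2l// ltW.
by apply: filterS => w hw t tI; apply: hw; rewrite /= in_itv.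
Qed.

Definition curvature_free (Omega : set 'rV[R]_2) (alpha beta : 'rV[R]_2 -> 'rV[R]_3) :=
  forall z, Omega z -> partial 1 alpha z - partial 0 beta z = cross (alpha z) (beta z).

Definition parallel (alpha beta : 'rV[R]_2 -> 'rV[R]_3) (U : set 'rV[R]_2)
    (eps : 'rV[R]_2 -> 'rV[R]_3) :=
  forall z, U z -> differentiable eps z /\
    forall v, 'd eps z v = cross (eps z) (lin2 (alpha z) (beta z) v).

Section Frame.
Variables (Omega : set 'rV[R]_2) (alpha beta : 'rV[R]_2 -> 'rV[R]_3).
Hypotheses (oO : open Omega) (a1 : of_class 1 Omega alpha) (b1 : of_class 1 Omega beta).
Hypothesis flat : curvature_free Omega alpha beta.

Lemma of_class1_continuous (g : 'rV[R]_2 -> 'rV[R]_3) q v t : of_class 1 Omega g ->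
  Omega (q + t *: v) -> {for t, continuous (fun s : R => g (q + s *: v))}.
Proof.
move=> [dg _] Oq; apply: (@continuous_comp _ _ _ (fun s : R => q + s *: v) g).
  exact: line_continuous.
by apply: differentiable_continuous; exact: dg.
Qed.

Lemma partial_continuous (g : 'rV[R]_2 -> 'rV[R]_3) i q v t : of_class 1 Omega g ->
  Omega (q + t *: v) -> {for t, continuous (fun s : R => partial i g (q + s *: v))}.
Proof.
move=> [_ cg] Oq; apply: (@continuous_comp _ _ _ (fun s : R => q + s *: v) (partial i g)).
  exact: line_continuous.
exact: cg.
Qed.

Definition ray q v (t : R) := lin2 (alpha (q + t *: v)) (beta (q + t *: v)) v.

(** Clamping time to [[0, 1]] extends the coefficient to all of R, continuous and bounded by 1/6, as
    [picard_small] requires. *)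
Lemma ray_solution (q v : 'rV[R]_2) e0 : (forall t : R, 0 <= t <= 1 -> Omega (q + t *: v)) ->
  (forall t : R, 0 <= t <= 1 -> `|ray q v t| <= 6^-1) ->
  exists e : R -> 'rV[R]_3, e 0 = e0 /\
    forall t : R, 0 <= t <= 1 -> is_derive t 1 e (cross (e t) (ray q v t)).
Proof.
move=> Oqv small.
have cI (t : R) : 0 <= clamp 0 1 t <= 1 by apply: clamp_itv.
have [||e [e0E de]] := @picard_small R (fun t => ray q v (clamp 0 1 t)) e0.
- move=> t; apply: (@continuous_comp _ _ _ (clamp 0 1) (ray q v)).
    exact: clamp_continuous.
  apply: (@cvg_lin2 _ _ _ _ _ (fun s => alpha (q + s *: v))
    (fun s => beta (q + s *: v)) (fun=> v)).
  + exact: of_class1_continuous a1 (Oqv _ (cI t)).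
  + exact: of_class1_continuous b1 (Oqv _ (cI t)).
  + exact: cvg_cst.
- by move=> t; exact: small.
exists e; split=> // t tI; have := de t tI; rewrite clamp_id//.
Qed.

(** The difference of two solutions satisfies the same homogeneous equation, so [spinning_norm_le]
    applies with [rho = 0]. *)
Lemma ray_solution_uniq q v (e e' : R -> 'rV[R]_3) : e 0 = e' 0 ->
  (forall t : R, 0 <= t <= 1 -> is_derive t 1 e (cross (e t) (ray q v t))) ->
  (forall t : R, 0 <= t <= 1 -> is_derive t 1 e' (cross (e' t) (ray q v t))) ->
  e 1 = e' 1.
Proof.
move=> ee' de de'; apply/eqP; rewrite -subr_eq0 -normr_le0.
have := @spinning_norm_le R (fun t => e t - e' t) (fun=> 0) (ray q v) 0.
rewrite mulr0; apply => [|t tI|t tI]; first by rewrite ee' subrr.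
  by rewrite addr0 crossBl; apply: is_derive_sub; [exact: de|exact: de'].
by rewrite normr0.
Qed.

Lemma parallel_ray U (eps : 'rV[R]_2 -> 'rV[R]_3) q v (t : R) :
  parallel alpha beta U eps -> U (q + t *: v) ->
  is_derive t 1 (fun s => eps (q + s *: v)) (cross (eps (q + t *: v)) (ray q v t)).
Proof.
move=> peps Uq; have [de deE] := peps _ Uq.
exact: is_derive_eq (is_derive_line_diff de) (deE v).
Qed.

Lemma parallel_uniq (U : set 'rV[R]_2) (eps eps' : 'rV[R]_2 -> 'rV[R]_3) q z :
  (forall t : R, 0 <= t <= 1 -> U (q + t *: (z - q))) ->
  parallel alpha beta U eps -> parallel alpha beta U eps' ->
  eps q = eps' q -> eps z = eps' z.
Proof.
move=> Uqz pe pe' eq.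
have zE : z = q + 1 *: (z - q) by rewrite scale1r addrC subrK.
rewrite zE; apply: (@ray_solution_uniq q (z - q) (fun s => eps (q + s *: (z - q)))
  (fun s => eps' (q + s *: (z - q)))).
- by rewrite scale0r addr0.
- by move=> t tI; exact: parallel_ray (Uqz t tI).
- by move=> t tI; exact: parallel_ray (Uqz t tI).
Qed.

Lemma is_derive_lin2 (f g : R -> 'rV[R]_3) (t : R) df dg w :
  is_derive t 1 f df -> is_derive t 1 g dg ->
  is_derive t 1 (fun s => lin2 (f s) (g s) w) (lin2 df dg w).
Proof.
by move=> hf hg; rewrite /lin2; exact: is_derive_add.
Qed.

(** The product rule produces the left side of [residualE], and flatness at [z] supplies the
    hypothesis of that identity. *)
Lemma ray_deviation q v w (e e' : R -> 'rV[R]_3) (t : R) :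
  Omega (q + t *: v) ->
  is_derive t 1 e (cross (e t) (ray q v t)) ->
  is_derive t 1 e' (cross (e' t) (ray q (v + w) t)) ->
  let z := q + t *: v in
  is_derive t 1 (fun s => e' s - e s -
      s *: cross (e s) (lin2 (alpha (q + s *: v)) (beta (q + s *: v)) w))
    (cross (e' t - e t - t *: cross (e t) (lin2 (alpha z) (beta z) w)) (ray q (v + w) t)
     + residual (e t) (alpha z) (beta z) (alpha (z + t *: w)) (beta (z + t *: w))
        (partial 0 alpha z) (partial 1 alpha z) (partial 0 beta z) (partial 1 beta z)
        v w t).
Proof.
move=> Oz de de' z.
have [da _] := a1; have [db _] := b1.
have hl := is_derive_lin2 w (is_derive_line_partial (da _ Oz))
  (is_derive_line_partial (db _ Oz)).
have h := is_derive_sub (is_derive_sub de' de)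
  (is_derive_scale (is_derive_id t 1) (is_derive_cross de hl)).
apply: (is_derive_eq h).
rewrite /ray -/z [q + t *: (v + w)](_ : _ = z + t *: w); last first.
  by rewrite /z scalerDr addrA.
exact: residualE (flat Oz).
Qed.

End Frame.
End Rays.

Section LocalExistence.
Variables (R : realType) (Omega : set 'rV[R]_2) (alpha beta : 'rV[R]_2 -> 'rV[R]_3).
Hypotheses (oO : open Omega) (a1 : of_class 1 Omega alpha) (b1 : of_class 1 Omega beta).
Hypothesis flat : curvature_free Omega alpha beta.

Lemma ray_data_bounded q v (e : R -> 'rV[R]_3) :
  (forall t : R, 0 <= t <= 1 -> Omega (q + t *: v)) ->
  (forall t : R, 0 <= t <= 1 -> {for t, continuous e}) ->
  exists2 M : R, 0 <= M & forall t : R, 0 <= t <= 1 -> let z := q + t *: v in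
    [/\ `|e t| <= M, `|alpha z| <= M & `|beta z| <= M] /\
    [/\ `|partial 0 alpha z| <= M, `|partial 1 alpha z| <= M,
      `|partial 0 beta z| <= M & `|partial 1 beta z| <= M].
Proof.
move=> Oqv ce.
have bnd (g : R -> 'rV[R]_3) : (forall t : R, 0 <= t <= 1 -> {for t, continuous g}) ->
    exists2 M : R, 0 <= M & forall t : R, 0 <= t <= 1 -> `|g t| <= M.
  move=> cg; have [|M hM] := @segment_bounded R (fun t => `|g t|).
    by move=> t tI; apply: cvg_norm; exact: cg.
  by exists M => //; apply: le_trans (hM 0 _); rewrite ?lexx ?ler01.
have [M1 p1 h1] := bnd e ce.
have [M2 p2 h2] := bnd _ (fun t tI => of_class1_continuous a1 (Oqv t tI)).
have [M3 p3 h3] := bnd _ (fun t tI => of_class1_continuous b1 (Oqv t tI)).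
have [M4 p4 h4] := bnd _ (fun t tI => partial_continuous (i := 0) a1 (Oqv t tI)).
have [M5 p5 h5] := bnd _ (fun t tI => partial_continuous (i := 1) a1 (Oqv t tI)).
have [M6 p6 h6] := bnd _ (fun t tI => partial_continuous (i := 0) b1 (Oqv t tI)).
have [M7 p7 h7] := bnd _ (fun t tI => partial_continuous (i := 1) b1 (Oqv t tI)).
exists (M1 + M2 + M3 + M4 + M5 + M6 + M7) => [|t tI z]; first by lra.
split; split; [apply: le_trans (h1 t tI) _|apply: le_trans (h2 t tI) _|
  apply: le_trans (h3 t tI) _|apply: le_trans (h4 t tI) _|apply: le_trans (h5 t tI) _|
  apply: le_trans (h6 t tI) _|apply: le_trans (h7 t tI) _]; lra.
Qed.

(** The section at [z] is the value at time 1 of the solution along the ray from [q] to [z]. The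
    bound 1/6 is the one under which Picard iteration contracts. *)
Lemma local_parallel p (r : R) : ball p r `<=` Omega ->
  (forall x y z, ball p r x -> ball p r y -> ball p r z ->
    `|lin2 (alpha z) (beta z) (y - x)| <= 6^-1) ->
  forall q e0, ball p r q ->
    exists eps, parallel alpha beta (ball p r) eps /\ eps q = e0.
Proof.
move=> bO small q e0 bq.
have seg z t : ball p r z -> 0 <= t <= 1 -> ball p r (q + t *: (z - q)).
  by move=> bz tI; exact: ball_segment.
have /choice[e he] : forall z, exists e : R -> 'rV[R]_3, ball p r z ->
    e 0 = e0 /\ forall t : R, 0 <= t <= 1 ->
      is_derive t 1 e (cross (e t) (ray alpha beta q (z - q) t)).
  move=> z; have [bz|nbz] := pselect (ball p r z); last by exists (fun=> 0).
  have [||f hf] := @ray_solution R Omega alpha beta a1 b1 q (z - q) e0.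
  - by move=> t tI; exact/bO/seg.
  - by move=> t tI; apply: small => //; exact: seg.
  by exists f.
exists (fun z => e z 1); split; last first.
  have [eq0 deq] := he q bq.
  (* The ray from [q] to itself has velocity 0, so the constant [e0] solves its equation. *)
  apply: (@ray_solution_uniq R alpha beta q (q - q) _ (fun=> e0)) => // t tI.
  rewrite /ray subrr [lin2 _ _ 0]linear0 [cross _ _](_ : _ = 0); last first.
    by apply: row3P; rewrite !entryE; ring.
  exact: is_derive_cst.
move=> z bz; have [ez0 dez] := he z bz.
have Oqz t : 0 <= t <= 1 -> Omega (q + t *: (z - q)) by move=> tI; exact/bO/seg.
suff [de deE] : differentiable (fun z => e z 1) z /\ forall w,
    'd (fun z => e z 1) z w = lin2 (cross (e z 1) (alpha z)) (cross (e z 1) (beta z)) w.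
  by split=> // w; rewrite cross_lin2; exact: deE.
apply: differentiable_lin2 => eta eta0.
have [M M0 hM] : exists2 M : R, 0 <= M & forall t : R, 0 <= t <= 1 ->
    let x := q + t *: (z - q) in
    [/\ `|e z t| <= M, `|alpha x| <= M & `|beta x| <= M] /\
    [/\ `|partial 0 alpha x| <= M, `|partial 1 alpha x| <= M,
      `|partial 0 beta x| <= M & `|partial 1 beta x| <= M].
  apply: ray_data_bounded => // t tI; apply: differentiable_continuous.
  by apply/derivable1_diffP; have [] := dez t tI.
set v := z - q in Oqz dez hM *.
pose V := `|v| + 1.
pose K := 4 * M * V + 8 * M * M + 8 * M * M * (V * (2 * (1 + 2 * M)) + 2 * M).
have V0 : 0 <= V by rewrite addr_ge0.
have K0 : 0 <= K by rewrite /K !addr_ge0 ?mulr_ge0 ?addr_ge0 ?mulr_ge0 ?addr_ge0 ?mulr_ge0.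
(* The bound 1 gives [|v + w| <= V]; the other makes [3 * K * d <= eta], with the 3 of
   [spinning_norm_le] and a 1 that keeps the denominator positive when [K = 0]. *)
pose d := Num.min 1 (eta / (3 * K + 1)).
have d0 : 0 < d by rewrite /d lt_min ltr01 divr_gt0// ltr_wpDl// mulr_ge0.
have d1 : d <= 1 by rewrite /d ge_min lexx.
have dK : 3 * K * d <= eta.
  apply: (@le_trans _ _ ((3 * K + 1) * d)); first by rewrite ler_wpM2r ?lerDl// ltW.
  by rewrite mulrC -ler_pdivlMr ?ltr_wpDl ?mulr_ge0// /d ge_min lexx orbT.
have na := segment_strict oO a1 Oqz d0.
have nb := segment_strict oO b1 Oqz d0.
have nw : \forall w \near (0 : 'rV[R]_2), `|w| < d by exact: nbhs0_lt.
have nz : \forall w \near (0 : 'rV[R]_2), ball p r (z + w).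
  have : \forall y \near z, ball p r y by apply: open_nbhs_nbhs; split=> //; exact: ball_open.
  move=> /near_norm[rho rho0 hrho]; have : \forall w \near (0 : 'rV[R]_2), `|w| < rho by exact: nbhs0_lt.
  by apply: filterS => w hw; apply: hrho; rewrite addrAC subrr add0r.
apply: filterS2 (filterI na nb) (filterI nw nz) => w [ha hb] [hw bzw].
have [ew0 dew] := he _ bzw.
have vwE : z + w - q = v + w by rewrite /v addrAC.
rewrite vwE in dew.
pose D t := e (z + w) t - e z t -
  t *: cross (e z t) (lin2 (alpha (q + t *: v)) (beta (q + t *: v)) w).
have zE : q + 1 *: v = z by rewrite scale1r /v addrC subrK.
have -> : e (z + w) 1 - e z 1 - lin2 (cross (e z 1) (alpha z)) (cross (e z 1) (beta z)) w = D 1.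
  by rewrite /D zE scale1r cross_lin2.
have h (t : R) (tI : 0 <= t <= 1) :=
  ray_deviation a1 b1 flat (Oqz t tI) (dez t tI) (dew t tI).
apply: (@le_trans _ _ (3 * (K * d * `|w|))); last first.
  by rewrite !mulrA ler_wpM2r.
apply: spinning_norm_le h _ => [|t tI].
  by rewrite /D ew0 ez0 subrr scale0r subrr.
have [[eM aM bM] [A0 A1 B0 B1]] := hM t tI.
have vwV : `|v + w| <= V.
  by rewrite (le_trans (ler_normD _ _))// lerD2l (le_trans (ltW hw) d1).
exact: residual_norm tI eM aM bM A0 A1 B0 B1 (ha t tI) (hb t tI) vwV (ltW hw) d1.
Qed.

End LocalExistence.

(** * Monodromy *)

Section Transport.
Variables (R : realType) (Omega : set 'rV[R]_2) (alpha beta : 'rV[R]_2 -> 'rV[R]_3).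
Hypotheses (oO : open Omega) (a1 : of_class 1 Omega alpha) (b1 : of_class 1 Omega beta).
Hypothesis flat : curvature_free Omega alpha beta.

Definition good p (r : R) := ball p r `<=` Omega /\ forall q e, ball p r q ->
  exists eps, parallel alpha beta (ball p r) eps /\ eps q = e.

Lemma good_ball p : Omega p -> exists2 r : R, 0 < r & good p r.
Proof.
move=> Op; have [da _] := a1; have [db _] := b1.
have nO : \forall z \near p, Omega z by apply: open_nbhs_nbhs.
have na : \forall z \near p, `|alpha p - alpha z| < 1.
  by move/cvgrPdist_lt: (differentiable_continuous (da _ Op)); apply.
have nb : \forall z \near p, `|beta p - beta z| < 1.
  by move/cvgrPdist_lt: (differentiable_continuous (db _ Op)); apply.
have [r0 r00 hr0] := near_norm (filterI nO (filterI na nb)).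
pose M := `|alpha p| + `|beta p| + 2.
have M0 : 0 < M by rewrite /M ltr_wpDl// addr_ge0.
(* On the ball [|alpha| + |beta| <= M] and differences of points are at most [2 * r], so the form is
   bounded by [2 * r * M <= 1/6]. *)
pose r := Num.min r0 (12 * M)^-1.
have rM : r * (12 * M) <= 1.
  by rewrite -ler_pdivlMr ?mulr_gt0// mul1r /r ge_min lexx orbT.
have r_gt0 : 0 < r by rewrite /r lt_min r00 invr_gt0 mulr_gt0.
have hr z : ball p r z -> [/\ Omega z, `|alpha p - alpha z| < 1 & `|beta p - beta z| < 1].
  rewrite -ball_normE /= distrC => zr.
  by have [] := hr0 z (lt_le_trans zr (_ : r <= r0)); [rewrite /r ge_min lexx|move=> ? []].
have bO : ball p r `<=` Omega by move=> z /hr[].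
exists r => //; split=> // q e bq.
apply: (local_parallel oO a1 b1 flat bO) => // x y z bx byy bz.
have [_ az bez] := hr z bz.
have yx : `|y - x| <= 2 * r.
  have := ler_distD p y x; move: bx byy; rewrite -!ball_normE /= (distrC y p); lra.
have azM : `|alpha z| + `|beta z| <= M.
  have := ler_distD (alpha p) (alpha z) 0; have := ler_distD (beta p) (beta z) 0.
  by rewrite !subr0 (distrC (alpha z)) (distrC (beta z)) /M; lra.
apply: le_trans (lin2_norm _ _ _) _.
apply: le_trans (_ : 2 * r * M <= _); last by lra.
by rewrite ler_pM// addr_ge0.
Qed.

Definition step q e q' e' := exists p (r : R) (eps : 'rV[R]_2 -> 'rV[R]_3),
  [/\ good p r, ball p r q, ball p r q' &
   [/\ parallel alpha beta (ball p r) eps, eps q = e & eps q' = e']].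

(** The two balls may differ, but their intersection is convex and contains both points, so the two
    sections agree along the segment from [q] to [q']. *)
Lemma step_fun q e q' e1 e2 : step q e q' e1 -> step q e q' e2 -> e1 = e2.
Proof.
move=> [p1 [r1 [f1 [_ b1q b1q' [pf1 f1q <-]]]]] [p2 [r2 [f2 [_ b2q b2q' [pf2 f2q <-]]]]].
apply: (@parallel_uniq R alpha beta (ball p1 r1 `&` ball p2 r2) f1 f2 q q').
- by move=> t tI; split; exact: ball_segment.
- by move=> z [z1 _]; exact: pf1.
- by move=> z [_ z2]; exact: pf2.
- by rewrite f1q f2q.
Qed.

(** The default 0 is taken only when no good ball contains both points; otherwise a value exists and
    [step_fun] makes it unique. *)
Definition transport q q' e : 'rV[R]_3 := xget 0 [set e' | step q e q' e'].

Definition neighbors q q' := exists p (r : R), [/\ good p r, ball p r q & ball p r q'].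

Lemma transportE p r eps q q' : good p r -> parallel alpha beta (ball p r) eps ->
  ball p r q -> ball p r q' -> transport q q' (eps q) = eps q'.
Proof.
move=> g pe bq bq'; have h : step q (eps q) q' (eps q') by exists p, r, eps.
have hT : step q (eps q) q' (transport q q' (eps q)).
  by apply: (@xgetPex _ 0 [set e' | step q (eps q) q' e']); exists (eps q').
exact: step_fun hT h.
Qed.

Lemma neighborsC q q' : neighbors q q' -> neighbors q' q.
Proof. by move=> [p [r [g bq bq']]]; exists p, r. Qed.

Lemma transport_comp p r q1 q2 q3 e : good p r -> ball p r q1 -> ball p r q2 ->
  ball p r q3 -> transport q2 q3 (transport q1 q2 e) = transport q1 q3 e.
Proof.
move=> g h1 h2 h3; have [eps [pe <-]] := g.2 q1 e h1.
by rewrite !(transportE g pe).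
Qed.

Lemma transport_refl q e : Omega q -> transport q q e = e.
Proof.
move=> /good_ball[r r0 g]; have bq : ball q r q by exact: ballxx.
by have [eps [pe <-]] := g.2 q e bq; rewrite (transportE g pe).
Qed.

Lemma transportK q q' e : neighbors q q' -> transport q' q (transport q q' e) = e.
Proof.
move=> [p [r [g bq bq']]]; rewrite (transport_comp _ g)// transport_refl//.
exact: g.1.
Qed.

Fixpoint carry (q : nat -> 'rV[R]_2) e n :=
  if n is n'.+1 then transport (q n') (q n) (carry q e n') else e.

Lemma eq_carry q q' e n : (forall k, (k <= n)%N -> q k = q' k) -> carry q e n = carry q' e n.
Proof.
elim: n => //= n ih h; rewrite ih => [|k kn]; last by rewrite h// ltnW.
by rewrite !h.
Qed.

Lemma carry_constant (q : nat -> 'rV[R]_2) c e n :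
  Omega c -> (forall k, (k <= n)%N -> q k = c) -> carry q e n = e.
Proof.
move=> Oc; elim: n => //= n ih h; rewrite !h// transport_refl// ih// => k kn.
by rewrite h// ltnW.
Qed.

(* Since transport around a cell is trivial, moving a row of the grid to the
   next one conjugates its transport by the transports along the two sides. *)
Lemma carry_grid (Q : nat -> nat -> 'rV[R]_2) c e m n :
  Omega c ->
  (forall i j, (i < m)%N -> (j < n)%N -> exists p r, [/\ good p r, ball p r (Q i j),
     ball p r (Q i.+1 j), ball p r (Q i j.+1) & ball p r (Q i.+1 j.+1)]) ->
  (forall i, (i <= m)%N -> Q i 0%N = c /\ Q i n = c) ->
  (forall j, (j <= n)%N -> Q m j = c) ->
  carry (Q 0%N) e n = e.
Proof.
move=> Oc cell side top.
have row i j : (i < m)%N -> (j <= n)%N ->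
    transport (Q i j) (Q i.+1 j) (carry (Q i) e j) = carry (Q i.+1) e j.
  move=> im; elim: j => [|j ih] jn /=.
    by rewrite (side i (ltnW im)).1 (side i.+1 im).1 transport_refl.
  have [p [r [g b00 b10 b01 b11]]] := cell i j im jn.
  by rewrite -ih ?(ltnW jn)// !(transport_comp _ g).
have all_rows i : (i <= m)%N -> carry (Q i) e n = carry (Q 0%N) e n.
  elim: i => // i ih im; rewrite -ih ?(ltnW im)// -row//.
  by rewrite (side i (ltnW im)).2 (side i.+1 im).2 transport_refl.
rewrite -(all_rows m (leqnn m)); exact: carry_constant Oc top.
Qed.

End Transport.

(** * Polygonal paths *)

Section Polygon.
Variable R : realType.
Implicit Types (q : nat -> 'rV[R]_2).

(** Piecewise linear path with vertex [q k] at time k / n. The i-th edge is added gradually during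
    [i / n, (i + 1) / n]; a single formula for all times makes continuity immediate. *)
Definition polygon q n (t : R) : 'rV[R]_2 :=
  q 0%N + \sum_(0 <= i < n) clamp 0 1 (n%:R * t - i%:R) *: (q i.+1 - q i).

Lemma polygon_continuous q n : continuous (polygon q n).
Proof.
rewrite /polygon; move: (n%:R) => c t; apply: cvgD; first exact: cvg_cst.
elim: n => [|n ih].
  by under eq_fun do rewrite big_geq//; rewrite big_geq//; exact: cvg_cst.
under eq_fun do rewrite big_nat_recr//=.
rewrite big_nat_recr//=; apply: cvgD; first exact: ih.
apply: cvgZr_tmp.
apply: (@continuous_comp _ _ _ (fun t : R => c * t - n%:R) (clamp 0 1)).
  apply: cvgB; last exact: cvg_cst.
  by apply: cvgM; [exact: cvg_cst|exact: cvg_id].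
exact: clamp_continuous.
Qed.

(** Edges before k have clamp 1 and telescope to [q k - q 0], edge k has clamp x, and later edges
    have clamp 0. *)
Lemma polygonE q n k (x : R) : (k < n)%N -> 0 <= x <= 1 ->
  polygon q n ((k%:R + x) / n%:R) = q k + x *: (q k.+1 - q k).
Proof.
move=> kn /andP[x0 x1]; have n0 : n%:R != 0 :> R by rewrite pnatr_eq0; case: n kn.
rewrite /polygon; under eq_bigr do rewrite mulrC divfK//.
rewrite (big_cat_nat _ (ltnW kn))//= [X in _ + (_ + X)]big_ltn//.
have -> : \sum_(0 <= i < k) clamp 0 1 (k%:R + x - i%:R) *: (q i.+1 - q i) = q k - q 0%N.
  rewrite -telescope_sumr//; apply: eq_big_nat => i /andP[_ ik].
  rewrite (_ : clamp _ _ _ = 1) ?scale1r// /clamp.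
  have : (i.+1)%:R <= k%:R :> R by rewrite ler_nat.
  rewrite -natr1 => h.
  by rewrite (min_idPl _) ?(max_idPr _)//; lra.
rewrite (_ : clamp 0 1 (k%:R + x - k%:R) = x); last first.
  by rewrite addrAC subrr add0r clamp_id// x0.
rewrite big_nat_cond big1 ?addr0; last first.
  move=> i /andP[/andP[ki _] _]; rewrite (_ : clamp _ _ _ = 0) ?scale0r// /clamp.
  have : k.+1%:R <= i%:R :> R by rewrite ler_nat.
  rewrite -natr1 => h.
  by rewrite (max_idPl _)// ge_min; apply/orP; right; lra.
by rewrite addrA [q 0%N + _]addrC subrK.
Qed.

Lemma polygon_param n (t : R) : (0 < n)%N -> 0 <= t <= 1 ->
  exists k (x : R), [/\ (k < n)%N, 0 <= x <= 1 & t = (k%:R + x) / n%:R].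
Proof.
move=> n0 /andP[t0 t1].
have n0' : 0 < n%:R :> R by rewrite ltr0n.
have key m (s : R) : (0 < m)%N -> 0 <= s <= m%:R ->
    exists k (x : R), [/\ (k < m)%N, 0 <= x <= 1 & s = k%:R + x].
  elim: m => // m ih _ /andP[s0]; rewrite -natr1 => sm.
  have [ms|sm'] := leP m%:R s.
    exists m, (s - m%:R); split; rewrite ?ltnSn//; last by rewrite addrC subrK.
    by apply/andP; split; lra.
  have m0 : (0 < m)%N by rewrite lt0n; apply: contraTneq sm' => ->; rewrite -leNgt.
  have [|k [x [km xI sE]]] := ih m0; first by rewrite s0 ltW.
  by exists k, x; split=> //; rewrite ltnW.
have [|k [x [kn xI sE]]] := key n (t * n%:R) n0.
  by apply/andP; split; [rewrite mulr_ge0// ltW|rewrite ler_piMl// ltW].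
by exists k, x; split=> //; rewrite -sE mulfK// gt_eqF.
Qed.

End Polygon.

(** * Triviality of transport around loops *)

Section Monodromy.
Variables (R : realType) (Omega : set 'rV[R]_2) (alpha beta : 'rV[R]_2 -> 'rV[R]_3).
Hypotheses (oO : open Omega) (a1 : of_class 1 Omega alpha) (b1 : of_class 1 Omega beta).
Hypothesis flat : curvature_free Omega alpha beta.

Local Notation good := (good Omega alpha beta).
Local Notation neighbors := (neighbors Omega alpha beta).
Local Notation transport := (transport Omega alpha beta).
Local Notation carry := (carry Omega alpha beta).

(** A Lebesgue number argument: the preimages of good balls cover the compact square, so sets of
    diameter about 1 / n are eventually mapped into a single good ball. *)
Lemma homotopy_grid (h : R * R -> 'rV[R]_2) :
  {within `[0, 1] `*` `[0, 1], continuous h} ->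
  (forall s t, s \in `[0, 1] -> t \in `[0, 1] -> Omega (h (s, t))) ->
  exists2 N, (0 < N)%N & forall z, (`[0, 1] `*` `[0, 1]) z -> forall n, (N <= n)%N ->
    exists p r, good p r /\ forall z', (`[0, 1] `*` `[0, 1]) z' ->
      `|z' - z| <= n%:R^-1 -> ball p r (h z').
Proof.
move=> ch Oh; set K := `[0, 1] `*` `[0, 1].
pose P n (z : R * R) := exists p r, good p r /\ forall z', K z' ->
      `|z' - z| <= n%:R^-1 -> ball p r (h z').
have cK : compact K by apply: compact_setX; exact: segment_compact.
have cov := (near_covering_withinP _).2 ((compact_near_coveringP _).1 cK).
have : \forall n \near \oo, K `<=` P n.
  apply: (cov _ \oo P _) => z0 Kz0.
  have Oz0 : Omega (h z0).
    by case: z0 Kz0 => s t /= [sI tI]; apply: Oh.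
  have [r r0 g] := good_ball oO a1 b1 flat Oz0.
  have /subspace_continuousP/(_ z0 Kz0) hz0 := ch.
  have : \forall z \near z0, K z -> ball (h z0) r (h z).
    by apply: (hz0 (ball (h z0) r)); exact: nbhsx_ballx.
  move=> /near_norm[d d0 hd].
  have nn : \forall n \near \oo, n%:R^-1 < d / 2.
    have d20 : 0 < d / 2 by rewrite divr_gt0.
    have [N _ hN] := near_infty_natSinv_lt (PosNum d20).
    exists N.+1 => // -[//|n] /=; rewrite ltnS => Nn; exact: (hN n Nn).
  have nz : \forall z \near z0, `|z0 - z| < d / 2.
    have d20 : 0 < d / 2 by rewrite divr_gt0.
    by have := nbhsx_ballx z0 (d / 2) d20; rewrite -ball_normE.
  (* Two distances below d / 2, from z0 to z and from z to z', keep z' within d of z0. *)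
  exists ([set z | `|z0 - z| < d / 2], [set n | n%:R^-1 < d / 2]) => //.
  move=> [z n] /= [hz hn] Kz; exists (h z0), r; split=> // z' Kz' z'z.
  apply: hd => //; have := ler_distD z z' z0; rewrite (distrC z z0); lra.
move=> [N _ hN]; exists N.+1 => // z Kz n Nn.
by apply: hN Kz => /=; exact: ltnW.
Qed.

(** Balls are convex, so the points subdividing an edge stay in the good ball of its endpoints,
    where consecutive transports compose to a single one. *)
Lemma carry_subdivided (q Q : nat -> 'rV[R]_2) n m e : (0 < m)%N ->
  (forall k, (k < n)%N -> neighbors (q k) (q k.+1)) ->
  (forall k j, (k < n)%N -> (j <= m)%N ->
    Q (k * m + j)%N = q k + (j%:R / m%:R) *: (q k.+1 - q k)) ->
  carry Q e (n * m) = carry q e n.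
Proof.
move=> m0 nq QE.
have key k : (k <= n)%N -> carry Q e (k * m) = carry q e k.
  elim: k => [|k ih] kn; first by rewrite mul0n.
  have [p [r [g b0 b1']]] := nq k kn.
  have bQ j : (j <= m)%N -> ball p r (Q (k * m + j)%N).
    move=> jm; rewrite QE//; apply: ball_segment => //.
    by rewrite divr_ge0//= ler_pdivrMr ?ltr0n// mul1r ler_nat.
  have sub j : (j <= m)%N -> carry Q e (k * m + j) =
      transport (q k) (Q (k * m + j)%N) (carry q e k).
    have Q0 : Q (k * m)%N = q k.
      by rewrite -[(k * m)%N]addn0 QE// mul0r scale0r addr0.
    elim: j => [|j ihj] jm.
      rewrite addn0 ih ?(ltnW kn)// Q0.
      by rewrite (transport_refl oO a1 b1 flat)//; exact: g.1.
    rewrite addnS /= -addnS ihj ?(ltnW jm)//.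
    exact: transport_comp _ g b0 (bQ _ (ltnW jm)) (bQ _ jm).
  rewrite mulSn addnC sub//= QE// divff ?pnatr_eq0 -?lt0n// scale1r.
  by rewrite addrC subrK.
exact: key.
Qed.

Lemma carry_loop (q : nat -> 'rV[R]_2) n e : loops_contractible Omega ->
  (forall k, (k < n)%N -> neighbors (q k) (q k.+1)) -> q n = q 0%N ->
  carry q e n = e.
Proof.
move=> lc nq qn0; have [->//|n0] := posnP n.
have n0' : n%:R != 0 :> R by rewrite pnatr_eq0 -lt0n.
have cO t : t \in `[0, 1]%R -> Omega (polygon q n t).
  rewrite in_itv/= => tI; have [k [x [kn xI ->]]] := polygon_param n0 tI.
  rewrite polygonE//; have [p [r [[bO _] b0 b1']]] := nq k kn.
  by apply: bO; exact: ball_segment.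
have c0 : polygon q n 0 = q 0%N.
  have := @polygonE R q n 0%N 0 n0; rewrite addr0 mul0r scale0r addr0.
  by apply; rewrite lexx ler01.
have c1 : polygon q n 1 = q n.
  have nn : (n.-1 < n)%N by rewrite prednK.
  have := @polygonE R q n n.-1 1 nn; rewrite natr1 prednK// divff//.
  by rewrite scale1r addrC subrK; apply; rewrite lexx ler01.
have c01 : polygon q n 0 = polygon q n 1 by rewrite c0 c1 qn0.
have cc : {within `[0, 1], continuous (polygon q n)}.
  exact/continuous_subspaceT/polygon_continuous.
have [h [ch Oh h0 h1 hside]] := lc _ cc cO c01.
have [m m0 hm] := homotopy_grid ch Oh.
(* A multiple of n, so that the vertices of the polygon are grid points, and at least m, so that
   each cell is mapped into a good ball. *)
pose N := (n * m)%N.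
have N0 : (0 < N)%N by rewrite muln_gt0 n0.
have N0' : 0 < N%:R :> R by rewrite ltr0n.
pose x i : R := i%:R / N%:R.
have xI i : (i <= N)%N -> x i \in `[0, 1]%R.
  by move=> iN; rewrite in_itv/= divr_ge0//= ler_pdivrMr// mul1r ler_nat.
have xN : x N = 1 by rewrite /x divff// gt_eqF.
have x0 : x 0%N = 0 by rewrite /x mul0r.
have xS i : x i.+1 - x i = N%:R^-1 by rewrite /x -mulrBl -natrB// subSnn mul1r.
(* The row of the grid at homotopy parameter 0 is the polygon with each edge cut into m pieces. *)
rewrite -(@carry_subdivided q (fun j => h (x 0%N, x j)) n m e)//; last first.
  move=> k j kn jm; rewrite x0 h0; last first.
    apply: xI; rewrite /N -(prednK n0) mulSn addnC leq_add// leq_mul2r.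
    by rewrite -ltnS prednK// kn orbT.
  rewrite -(polygonE q kn); last first.
    by rewrite divr_ge0//= ler_pdivrMr ?ltr0n// mul1r ler_nat.
  congr polygon; rewrite /x /N natrD !natrM.
  have m0' : m%:R != 0 :> R by rewrite pnatr_eq0 -lt0n.
  by field; rewrite n0' m0'.
apply: (@carry_grid R Omega alpha beta oO a1 b1 flat (fun i j => h (x i, x j))
  (polygon q n 0) e N N).
- by apply: cO; rewrite in_itv/= lexx ler01.
- move=> i j iN jN.
  have Kz k l : (k <= N)%N -> (l <= N)%N -> (`[0, 1] `*` `[0, 1]) (x k, x l).
    by move=> kN lN; split; exact: xI.
  have [p [r [g hb]]] := hm _ (Kz i j (ltnW iN) (ltnW jN)) N (leq_pmull _ n0).
  have hb' k l : (k <= N)%N -> (l <= N)%N -> `|x k - x i| <= N%:R^-1 ->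
      `|x l - x j| <= N%:R^-1 -> ball p r (h (x k, x l)).
    move=> kN lN hk hl; apply: hb; first exact: Kz.
    by rewrite [leLHS]/Num.norm/= ge_max; apply/andP.
  have Ni0 : 0 <= N%:R^-1 :> R by rewrite invr_ge0.
  exists p, r; split=> //; apply: hb'; rewrite ?subrr ?normr0 ?xS ?ger0_norm//; exact: ltnW.
- by move=> i iN; rewrite x0 xN; exact: hside (xI i iN).
- by move=> j jN; rewrite xN h1// xI.
Qed.

End Monodromy.

Lemma near_eq_differentiable (R : realType) (V W : normedModType R) (f g : V -> W) z :
  (\forall y \near z, f y = g y) -> differentiable g z ->
  differentiable f z /\ forall v, 'd f z v = 'd g z v.
Proof.
move=> fg dg; apply: differentiable_linear; first exact: diff_continuous.
move=> eps eps0; have /eqaddoP/(_ _ eps0) := diff_locally dg.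
have fgz : f z = g z by exact: nbhs_singleton fg.
have [r r0 hr] := near_norm fg.
have : \forall w \near (0 : V), `|w| < r by exact: nbhs0_lt.
apply: filterS2 => w wr; rewrite -[(_ - _) w]/(g (w + z) - (g z + 'd g z w)) opprD addrA.
by rewrite fgz hr ?[w + z]addrC// addrAC subrr add0r.
Qed.

(** * Global parallel sections *)

Section GlobalSection.
Variables (R : realType) (Omega : set 'rV[R]_2) (alpha beta : 'rV[R]_2 -> 'rV[R]_3).
Hypotheses (oO : open Omega) (a1 : of_class 1 Omega alpha) (b1 : of_class 1 Omega beta).
Hypothesis flat : curvature_free Omega alpha beta.

Local Notation neighbors := (neighbors Omega alpha beta).
Local Notation transport := (transport Omega alpha beta).
Local Notation carry := (carry Omega alpha beta).

(** Transport along finite chains, recording the end point and the resulting vector. In this form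
    chains are concatenated and reversed by induction; [reach_carry] converts them to sequences for
    the grid argument. *)
Inductive reach (x : 'rV[R]_2) (e : 'rV[R]_3) : 'rV[R]_2 -> 'rV[R]_3 -> Prop :=
| reach0 : reach x e x e
| reachS y f z : reach x e y f -> neighbors y z -> reach x e z (transport y z f).

Lemma reach_trans x e y f z g : reach x e y f -> reach y f z g -> reach x e z g.
Proof. by move=> xy; elim=> // u h v _ xu uv; exact: reachS. Qed.

Lemma reach_sym x e y f : reach x e y f -> reach y f x e.
Proof.
elim=> [|u h v _ ux uv]; first exact: reach0.
apply: reach_trans ux; have vu := neighborsC uv.
rewrite -[in X in reach _ _ _ X](transportK oO a1 b1 flat h uv).
by apply: reachS vu; exact: reach0.
Qed.

Lemma reach_carry x e y f : reach x e y f -> exists q n,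
  [/\ q 0%N = x, q n = y, carry q e n = f &
      forall k, (k < n)%N -> neighbors (q k) (q k.+1)].
Proof.
elim=> [|u h v _ [q [n [q0 qn qe nq]]] uv]; first by exists (fun=> x), 0%N.
exists (fun k => if (k <= n)%N then q k else v), n.+1; split => //.
- by rewrite ltnn.
- rewrite /= leqnn ltnn qn (@eq_carry _ _ _ _ _ q) ?qe// => k ->//.
move=> k; rewrite ltnS => kn; rewrite kn.
by case: ltngtP kn => // [kn|->] _; [exact: nq|rewrite qn].
Qed.

Lemma reach_loop x e f : loops_contractible Omega -> reach x e x f -> f = e.
Proof.
move=> lc /reach_carry[q [n [q0 qn <- nq]]].
by apply: (carry_loop oO a1 b1 flat) => //; rewrite qn.
Qed.

Lemma reach_ball p e x (r : R) y z : good Omega alpha beta x r -> ball x r y ->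
  ball x r z -> (exists f, reach p e y f) -> exists f, reach p e z f.
Proof.
move=> g xy xz [f pf]; exists (transport y z f).
by apply: reachS pf _; exists x, r.
Qed.

(** By connectedness: within a good ball either all points are reachable or none is, so the
    reachable and the unreachable part of [Omega] are both open. *)
Lemma reach_all p e y : connected Omega -> Omega p -> Omega y ->
  exists f, reach p e y f.
Proof.
move=> cO Op Oy; pose S z := exists f, reach p e z f.
pose B := [set z | Omega z /\ S z].
have oB : open B.
  rewrite openE => x [Ox Sx]; have [r r0 g] := good_ball oO a1 b1 flat Ox.
  apply/nbhs_ballP; exists r => // z xz; split; first exact: g.1.
  by apply: reach_ball g _ xz Sx; exact: ballxx.
have oC : open [set z | Omega z /\ ~ S z].
  rewrite openE => x [Ox Sx]; have [r r0 g] := good_ball oO a1 b1 flat Ox.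
  apply/nbhs_ballP; exists r => // z xz; split; first exact: g.1.
  by move=> Sz; apply: Sx; apply: reach_ball g xz _ Sz; exact: ballxx.
have BE : B = Omega.
  apply: cO.
  - by exists p; split=> //; exists e; exact: reach0.
  - by exists B => //; apply/seteqP; split=> [z [Oz Sz]|z []].
  - exists (~` [set z | Omega z /\ ~ S z]); first by rewrite closedC.
    apply/seteqP; split=> [z [Oz Sz]|z [Oz nSz]]; split=> //; first by case.
    by apply: contrapT => nS; apply: nSz.
by have [] : B y by rewrite BE.
Qed.

Lemma reach_uniq p e y f g : loops_contractible Omega ->
  reach p e y f -> reach p e y g -> f = g.
Proof.
by move=> lc pf pg; apply: (@reach_loop y) => //; apply: reach_trans pf; exact: reach_sym.
Qed.

(** The section takes at each point the vector reached there from [p], which is unique because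
    closed chains transport trivially. Near [y] it coincides with the local section through [eps y],
    and so inherits the equation. *)
Theorem global_parallel p e : connected Omega -> loops_contractible Omega -> Omega p ->
  exists eps, parallel alpha beta Omega eps /\ eps p = e.
Proof.
move=> cO lc Op.
have [eps epsP] : exists eps : 'rV[R]_2 -> 'rV[R]_3,
    forall y, Omega y -> reach p e y (eps y).
  exists (fun y => xget 0 [set f | reach p e y f]) => y Oy.
  by apply: (@xgetPex _ 0 [set f | reach p e y f]); exact: reach_all.
exists eps; split; last by apply: reach_uniq (epsP p Op) _ => //; exact: reach0.
move=> y Oy; have [r r0 g] := good_ball oO a1 b1 flat Oy.
have by_ : ball y r y by exact: ballxx.
have [E [pE Ey]] := g.2 y (eps y) by_.
have epsE z : ball y r z -> eps z = E z.
  move=> bz; apply: reach_uniq (epsP z (g.1 _ bz)) _ => //.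
  rewrite -(transportE g pE by_ bz) Ey.
  by apply: reachS (epsP y Oy) _; exists y, r.
have [dE dEE] := pE y by_.
have [|deps depsE] := @near_eq_differentiable R _ _ eps E y _ dE.
  by have := nbhsx_ballx y r r0; apply: filterS => z; exact: epsE.
split=> [|v]; first exact: deps.
exact: etrans (depsE v) (etrans (dEE v) (congr1 (fun u => cross u _) Ey)).
Qed.

End GlobalSection.

(** * Mixed derivatives and the curvature equation *)

Section Young.
Variable R : realType.

Lemma differentiable_row (V : normedModType R) n (M : V -> 'rV[R]_n) z :
  (forall i, differentiable (fun y => M y 0 i) z) -> differentiable M z.
Proof.
move=> dM; rewrite (_ : M = \sum_(i < n) (fun y => M y 0 i *: delta_mx 0 i)).
  by apply: differentiable_sum => i; exact: differentiableZl.
by apply/funext => y; rewrite fct_sumE {1}[M y]row_sum_delta.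
Qed.

Lemma differentiable_entry (V : normedModType R) n (M : V -> 'rV[R]_n) z i :
  differentiable M z -> differentiable (fun y => M y 0 i) z.
Proof.
move=> dM; apply: (@differentiable_comp _ _ _ _ M (fun N : 'rV[R]_n => N 0 i)) => //.
exact: differentiable_coord.
Qed.

Lemma differentiable_cross (V : normedModType R) (f g : V -> 'rV[R]_3) z :
  differentiable f z -> differentiable g z ->
  differentiable (fun y => cross (f y) (g y)) z.
Proof.
move=> df dg; apply: differentiable_row => i; under eq_fun do rewrite mxE.
by apply: differentiableB; apply: differentiableM; exact: differentiable_entry.
Qed.

Lemma difference_split n (a b c l m : 'rV[R]_n) :
  a - b - m = (a - c - (l + m)) - (b - c - l).
Proof. by apply/rowP => i; rewrite !mxE; ring. Qed.

Lemma difference_regroup n (a b c d l : 'rV[R]_n) :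
  a - b - c + d - l = a - b - l - (c - d).
Proof. by apply/rowP => i; rewrite !mxE; ring. Qed.

(** The mean value inequality in the direction u is applied to x |-> g(p + s v + x u) - g(p + x u) -
    x s D_v h(p); its derivative is small compared with s because [h] is differentiable at [p]. *)
Lemma second_difference (V : normedModType R) n (g h : V -> 'rV[R]_n) p u v (eps : R) :
  (\forall z \near p, is_derive z u g (h z)) -> differentiable h p -> 0 < eps ->
  exists2 d : R, 0 < d & forall s, 0 < s < d ->
    `|g (p + s *: u + s *: v) - g (p + s *: u) - g (p + s *: v) + g p
      - s *: (s *: 'D_v h p)| <= eps * (s * s).
Proof.
move=> gh dh eps0; rewrite (deriveE v dh).
(* For x <= s the increments satisfy |x u + s v| + |x u| <= s c, which is the total multiplied by
   the differentiability error. *)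
pose c := 2 * `|u| + `|v| + 1.
have c0 : 0 < c by rewrite ltr_wpDl// addr_ge0// mulr_ge0.
have /eqaddoP/(_ _ (divr_gt0 eps0 c0)) := diff_locally dh.
move=> /near_norm[r1 r10 h1]; have [r2 r20 h2] := near_norm gh.
have {}h1 w : `|w| < r1 -> `|h (p + w) - h p - 'd h p w| <= eps / c * `|w|.
  by have := h1 w; rewrite subr0 -[(_ - _) w]/(h (w + p) - (h p + 'd h p w)) opprD addrA
    [w + p]addrC.
exists (Num.min r1 r2 / c); first by rewrite divr_gt0// lt_min r10.
move=> s /andP[s0]; rewrite ltr_pdivlMr// lt_min => /andP[s1 s2].
have dp a : p + a - p = a by rewrite addrC addKr.
have xu x : 0 <= x <= s -> `|x *: u| <= s * `|u|.
  by move=> /andP[x0 xs]; rewrite normrZ ger0_norm// ler_wpM2r.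
have xuv x : 0 <= x <= s -> `|x *: u + s *: v| <= s * (`|u| + `|v|).
  move=> xI; rewrite (le_trans (ler_normD _ _))// mulrDr lerD ?xu//.
  by rewrite normrZ ger0_norm// ltW.
have u0 := normr_ge0 u; have v0 := normr_ge0 v.
have su0 : 0 <= s * `|u| by rewrite mulr_ge0// ltW.
have sv0 : 0 <= s * `|v| by rewrite mulr_ge0// ltW.
pose L := 'd h p v.
pose G x := g (p + s *: v + x *: u) - g (p + x *: u) - x *: (s *: L).
have dG (x : R) : 0 <= x <= s -> is_derive x 1 G
    (h (p + s *: v + x *: u) - h (p + x *: u) - s *: L).
  move=> xI; apply: is_derive_sub; first apply: is_derive_sub.
  - apply: is_derive_line; apply: h2; rewrite -(addrA p) dp addrC.
    by apply: le_lt_trans (xuv x xI) _; move: s2; rewrite /c; lra.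
  - apply: is_derive_line; apply: h2; rewrite dp.
    by apply: le_lt_trans (xu x xI) _; move: s2; rewrite /c; lra.
  - have := is_derive_scale (is_derive_id x 1) (is_derive_cst (s *: L) x 1).
    by rewrite scaler0 addr0 scale1r.
have -> : g (p + s *: u + s *: v) - g (p + s *: u) - g (p + s *: v) + g p
      - s *: (s *: L) = G s - G 0.
  rewrite /G !scale0r !addr0 subr0 [p + s *: u + _]addrAC.
  exact: difference_regroup.
have -> : eps * (s * s) = eps * s * (s - 0) by rewrite subr0 mulrA.
apply: mean_value_le dG _; first exact: ltW.
move=> x xI; have A := h1 (x *: u + s *: v); have B := h1 (x *: u).
have lin : 'd h p (x *: u + s *: v) = 'd h p (x *: u) + s *: L.
  by rewrite linearD [X in _ + X]linearZ.
have px : p + s *: v + x *: u = p + (x *: u + s *: v) by rewrite -addrA [s *: v + _]addrC.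
rewrite px (difference_split _ _ (h p) ('d h p (x *: u))) -lin.
apply: le_trans (ler_normB _ _) _.
have r1uv : `|x *: u + s *: v| < r1.
  by apply: le_lt_trans (xuv x xI) _; move: s1; rewrite /c; lra.
have r1u : `|x *: u| < r1.
  by apply: le_lt_trans (xu x xI) _; move: s1; rewrite /c; lra.
apply: le_trans (lerD (A r1uv) (B r1u)) _.
rewrite -mulrDr; apply: (@le_trans _ _ (eps / c * (s * c))); last first.
  by rewrite [s * c]mulrC mulrA divfK ?gt_eqF// mulrA.
rewrite ler_wpM2l ?divr_ge0 ?ltW//.
have := lerD (xuv x xI) (xu x xI); rewrite /c; lra.
Qed.

(** The second difference is symmetric in u and v, and within eps / 2 times s^2 of s^2 times either
    mixed derivative. *)
Lemma young (V : normedModType R) n (g hu hv : V -> 'rV[R]_n) p u v :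
  (\forall z \near p, is_derive z u g (hu z)) ->
  (\forall z \near p, is_derive z v g (hv z)) ->
  differentiable hu p -> differentiable hv p -> 'D_v hu p = 'D_u hv p.
Proof.
move=> gu gv du dv; apply/eqP; rewrite -subr_eq0 -normr_le0; apply/ler_addgt0Pr => eps eps0.
have e2 : 0 < eps / 2 by rewrite divr_gt0.
have [d1 d10 h1] := second_difference v gu du e2.
have [d2 d20 h2] := second_difference u gv dv e2.
pose s := Num.min d1 d2 / 2.
have s0 : 0 < s by rewrite divr_gt0// lt_min d10.
have sd : s < Num.min d1 d2 by rewrite /s gtr_pMr ?lt_min ?d10//; lra.
have [s1 s2] : 0 < s < d1 /\ 0 < s < d2 by move: sd; rewrite lt_min s0 => /andP[-> ->].
have := h1 s s1; have := h2 s s2.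
have -> : g (p + s *: v + s *: u) - g (p + s *: v) - g (p + s *: u) =
    g (p + s *: u + s *: v) - g (p + s *: u) - g (p + s *: v).
  by rewrite (addrAC p (s *: v) (s *: u)); exact: addrAC.
move: (_ + g p) ('D_v hu p) ('D_u hv p) => T x y Ty Tx.
have ss0 : 0 < s * s by rewrite mulr_gt0.
rewrite add0r -(ler_pM2l ss0) -{1}[s * s]gtr0_norm// -normrZ -scalerA scalerBr scalerBr.
have := ler_distD T (s *: (s *: x)) (s *: (s *: y)); rewrite distrC in Tx.
lra.
Qed.

End Young.

(** * Path independence and vanishing curvature *)

Section Flatness.
Variables (R : realType) (Omega : set 'rV[R]_2) (alpha beta : 'rV[R]_2 -> 'rV[R]_3).
Hypotheses (oO : open Omega) (a1 : of_class 1 Omega alpha) (b1 : of_class 1 Omega beta).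

Lemma lin2_delta0 n (a b : 'rV[R]_n) : lin2 a b (delta_mx 0 0) = a.
Proof. by rewrite /lin2 !mxE/= scale1r scale0r addr0. Qed.

Lemma lin2_delta1 n (a b : 'rV[R]_n) : lin2 a b (delta_mx 0 1) = b.
Proof. by rewrite /lin2 !mxE/= scale1r scale0r add0r. Qed.

Lemma is_derive_partial (g : 'rV[R]_2 -> 'rV[R]_3) i z :
  differentiable g z -> is_derive z (delta_mx 0 i) g (partial i g z).
Proof. by move=> dg; apply: DeriveDef; [exact: diff_derivable|]. Qed.

Lemma parallel_derive eps z v : parallel alpha beta Omega eps -> Omega z ->
  is_derive z v eps (cross (eps z) (lin2 (alpha z) (beta z) v)).
Proof.
move=> pe /pe[de deE]; apply: DeriveDef; first exact: diff_derivable.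
exact: etrans (deriveE v de) (deE v).
Qed.

Lemma cross_eq0 (x : 'rV[R]_3) : (forall e, cross e x = 0) -> x = 0.
Proof.
move=> h; have e i j := congr1 (fun u : 'rV[R]_3 => u 0 i) (h (delta_mx 0 j)).
apply: row3P; rewrite entry0.
- have := e 2 1; rewrite cross2E entry0 !mxE/= mul0r mul1r sub0r => /eqP.
  by rewrite oppr_eq0 => /eqP.
- by have := e 2 0; rewrite cross2E entry0 !mxE/= mul0r mul1r subr0.
- have := e 1 0; rewrite cross1E entry0 !mxE/= mul0r mul1r sub0r => /eqP.
  by rewrite oppr_eq0 => /eqP.
Qed.

Lemma parallel_curvature : (forall p, Omega p -> forall e,
    exists eps, parallel alpha beta Omega eps /\ eps p = e) ->
  curvature_free Omega alpha beta.
Proof.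
(* The initial value at [p] can be prescribed, so the curvature defect vanishes once its cross
   product with every [e] does. *)
move=> ex p Op; apply/eqP; rewrite -subr_eq0; apply/eqP/cross_eq0 => e.
have [eps [pe <-]] := ex p Op e.
have nO : \forall z \near p, Omega z by apply: open_nbhs_nbhs.
have d0 : \forall z \near p, is_derive z (delta_mx 0 0) eps (cross (eps z) (alpha z)).
  by apply: filterS nO => z Oz; have := parallel_derive (delta_mx 0 0) pe Oz; rewrite lin2_delta0.
have d1 : \forall z \near p, is_derive z (delta_mx 0 1) eps (cross (eps z) (beta z)).
  by apply: filterS nO => z Oz; have := parallel_derive (delta_mx 0 1) pe Oz; rewrite lin2_delta1.
have [de _] := pe p Op; have [da _] := a1; have [db _] := b1.
have := young d0 d1 (differentiable_cross de (da p Op)) (differentiable_cross de (db p Op)).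
have h1 := is_derive_cross (parallel_derive (delta_mx 0 1) pe Op)
  (is_derive_partial 1 (da p Op)).
have h0 := is_derive_cross (parallel_derive (delta_mx 0 0) pe Op)
  (is_derive_partial 0 (db p Op)).
have -> := @derive_val _ _ _ _ _ _ _ h1.
have -> := @derive_val _ _ _ _ _ _ _ h0.
rewrite lin2_delta0 lin2_delta1.
(* [H] is the equality of mixed derivatives, (x x b) x a + x x a' = (x x a) x b + x x b'. *)
move: (eps p) (alpha p) (beta p) (partial 1 alpha p) (partial 0 beta p) => x a b a' b' H.
rewrite 2!crossBr -cross_jacobi.
move: (cross (cross x b) a) (cross x a') (cross (cross x a) b) (cross x b') H => P A Q B H.
have -> : A - B - (Q - P) = (P + A) - (Q + B) by apply/rowP => i; rewrite !mxE; ring.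
by rewrite H subrr.
Qed.

Theorem flat_iff_parallel : connected Omega -> loops_contractible Omega ->
  curvature_free Omega alpha beta <-> forall p, Omega p -> forall e,
    exists eps, parallel alpha beta Omega eps /\ eps p = e.
Proof.
move=> cO lc; split=> [flat p Op e|]; last exact: parallel_curvature.
exact: (global_parallel oO a1 b1 flat).
Qed.

End Flatness.

(** * The induced geometry *)

Section ScalarC1.
Variables (R : realType) (Omega : set 'rV[R]_2).
Hypothesis oO : open Omega.
Implicit Types (g h : 'rV[R]_2 -> R).

Local Notation delta i := (delta_mx 0 i : 'rV[R]_2).

(** Scalar class C^1, stable under the operations that build the connection form from the metric
    coefficients; [of_class1_entries] leads back to vector maps. *)
Definition scalarC1 g := (forall z, Omega z -> differentiable g z) /\
  forall i z, Omega z -> {for z, continuous ('D_(delta i) g)}.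

Lemma near_eq_continuous (T : topologicalType) (F G : 'rV[R]_2 -> T) z :
  (forall y, Omega y -> F y = G y) -> Omega z ->
  {for z, continuous G} -> {for z, continuous F}.
Proof.
move=> FG Oz cG; rewrite /prop_for /continuous_at FG//.
have nO : \forall y \near z, Omega y by exact: open_nbhs_nbhs.
move=> A /cG hA; apply: filterS2 nO hA => y /FG yE GA.
by rewrite /= yE.
Qed.

(** Since [Omega] is open, a formula for the derivative valid on [Omega] determines its continuity
    there. *)
Lemma scalarC1_intro g : (forall z, Omega z -> differentiable g z) ->
  (forall i, exists dg, forall z, Omega z ->
    is_derive z (delta i) g (dg z) /\ {for z, continuous dg}) -> scalarC1 g.
Proof.
move=> dg h; split=> // i z Oz; have [d hd] := h i.
apply: (@near_eq_continuous _ _ d) => //; last by have [] := hd z Oz.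
by move=> y /hd[dy _]; exact: derive_val.
Qed.

Lemma scalarC1_derive g i z : scalarC1 g -> Omega z ->
  is_derive z (delta i) g ('D_(delta i) g z).
Proof. by move=> [dg _] Oz; apply: DeriveDef => //; exact/diff_derivable/dg. Qed.

Lemma scalarC1_continuous g z : scalarC1 g -> Omega z -> {for z, continuous g}.
Proof. by move=> [dg _] Oz; exact/differentiable_continuous/dg. Qed.

Lemma scalarC1_cst (c : R) : scalarC1 (fun=> c).
Proof.
apply: scalarC1_intro => [z Oz|i]; first exact: differentiable_cst.
by exists (fun=> 0) => z Oz; split; [exact: is_derive_cst|exact: cst_continuous].
Qed.

Lemma scalarC1D g h : scalarC1 g -> scalarC1 h -> scalarC1 (fun z => g z + h z).
Proof.
move=> Cg Ch; apply: scalarC1_intro => [z Oz|i].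
  by apply: differentiableD; [exact: Cg.1|exact: Ch.1].
exists (fun z => 'D_(delta i) g z + 'D_(delta i) h z) => z Oz; split.
  by apply: is_derive_addR; exact: scalarC1_derive.
exact: cvgD (Cg.2 i z Oz) (Ch.2 i z Oz).
Qed.

Lemma scalarC1B g h : scalarC1 g -> scalarC1 h -> scalarC1 (fun z => g z - h z).
Proof.
move=> Cg Ch; apply: scalarC1_intro => [z Oz|i].
  by apply: differentiableB; [exact: Cg.1|exact: Ch.1].
exists (fun z => 'D_(delta i) g z - 'D_(delta i) h z) => z Oz; split.
  by apply: is_derive_subR; exact: scalarC1_derive.
exact: cvgB (Cg.2 i z Oz) (Ch.2 i z Oz).
Qed.

Lemma scalarC1M g h : scalarC1 g -> scalarC1 h -> scalarC1 (fun z => g z * h z).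
Proof.
move=> Cg Ch; apply: scalarC1_intro => [z Oz|i].
  by apply: differentiableM; [exact: Cg.1|exact: Ch.1].
exists (fun z => 'D_(delta i) g z * h z + g z * 'D_(delta i) h z) => z Oz; split.
  by apply: is_derive_mul; exact: scalarC1_derive.
exact: cvgD (cvgM (Cg.2 i z Oz) (scalarC1_continuous Ch Oz))
  (cvgM (scalarC1_continuous Cg Oz) (Ch.2 i z Oz)).
Qed.

Lemma scalarC1_comp g (phi dphi : R -> R) : scalarC1 g ->
  (forall z, Omega z -> is_derive (g z) 1 phi (dphi (g z))) ->
  (forall z, Omega z -> {for g z, continuous dphi}) ->
  scalarC1 (fun z => phi (g z)).
Proof.
move=> Cg hphi cphi.
have dphi' z : Omega z -> differentiable phi (g z).
  by move=> /hphi[? _]; exact/derivable1_diffP.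
have dcomp z : Omega z -> differentiable (phi \o g) z.
  by move=> Oz; apply: differentiable_comp; [exact: Cg.1|exact: dphi'].
apply: scalarC1_intro => [z Oz|i]; first exact: dcomp.
exists (fun z => 'D_(delta i) g z * dphi (g z)) => z Oz; split.
  apply: DeriveDef; first exact/diff_derivable/dcomp.
  rewrite (deriveE _ (dcomp z Oz)) diff_comp//=; [|exact: Cg.1|exact: dphi'].
  have [_ e] := hphi z Oz; have [dp _] := hphi z Oz.
  by rewrite (deriv1E dp) derive1E e -(deriveE _ (Cg.1 z Oz)).
exact: cvgM (Cg.2 i z Oz) (continuous_comp (scalarC1_continuous Cg Oz) (cphi z Oz)).
Qed.

Lemma scalarC1_invsqrt g : scalarC1 g -> (forall z, Omega z -> 0 < g z) ->
  scalarC1 (fun z => (Num.sqrt (g z))^-1).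
Proof.
move=> Cg g0.
apply: (@scalarC1_comp g (fun x => (Num.sqrt x)^-1)
  (fun x => - (Num.sqrt x ^+ 2)^-1 * (2 * Num.sqrt x)^-1) Cg) => z Oz.
  have s0 : Num.sqrt (g z) != 0 by rewrite gt_eqF// sqrtr_gt0 g0.
  have ds := is_derive1_sqrt (g0 z Oz).
  apply: DeriveDef; first exact: derivableV.
  by rewrite deriveV// derive_val.
have s0 : Num.sqrt (g z) != 0 by rewrite gt_eqF// sqrtr_gt0 g0.
apply: cvgM.
  apply: cvgN; apply: cvgV; first by rewrite expf_neq0.
  by apply: cvgM; exact: sqrt_continuous.
apply: cvgV; first by rewrite mulf_neq0.
by apply: cvgM; [exact: cvg_cst|exact: sqrt_continuous].
Qed.

Lemma scalarC1_entry (u : 'rV[R]_2 -> 'rV[R]_3) k :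
  of_class 1 Omega u -> scalarC1 (fun z => u z 0 k).
Proof.
move=> [du cu]; apply: scalarC1_intro => [z Oz|i].
  exact/differentiable_entry/du.
exists (fun z => partial i u z 0 k) => z Oz; split.
  by have /is_derive_coordP := is_derive_partial i (du z Oz).
exact: ((cvg_rowP _ _ _).1 (cu i z Oz)).
Qed.

Lemma of_class1_entries (u : 'rV[R]_2 -> 'rV[R]_3) :
  (forall k, scalarC1 (fun z => u z 0 k)) -> of_class 1 Omega u.
Proof.
move=> Cu; have du z : Omega z -> differentiable u z.
  by move=> Oz; apply: differentiable_row => k; exact: (Cu k).1.
split=> // i z Oz; apply/(cvg_rowP (nbhs_filter z)) => k.
apply: (@near_eq_continuous _ (fun y => partial i u y 0 k)
  ('D_(delta i) (fun y => u y 0 k))) => // [y Oy|]; last exact: (Cu k).2.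
have /is_derive_coordP/(_ k) h := is_derive_partial i (du y Oy).
by rewrite (@derive_val _ _ _ _ _ _ _ h).
Qed.

End ScalarC1.

(** * Two-by-two matrices and vector identities *)

Section Algebra.
Variable R : realType.
Implicit Types (u v : 'rV[R]_3) (M : 'M[R]_2).

Lemma sum_I2 (V : nmodType) (F : 'I_2 -> V) : \sum_i F i = F 0 + F 1.
Proof.
by rewrite !big_ord_recl big_ord0 addr0; congr (_ + F _); exact: val_inj.
Qed.

Lemma det_mx2 M : \det M = M 0 0 * M 1 1 - M 0 1 * M 1 0.
Proof.
rewrite (expand_det_row _ 0) sum_I2 /cofactor !det_mx11 !mxE.
rewrite expr0 expr1 mul1r mulN1r mulrN; congr (_ * _ - _ * _);
  by congr (M _ _); exact: val_inj.
Qed.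

Lemma invmx2 M : \det M != 0 ->
  [/\ invmx M 0 0 = (\det M)^-1 * M 1 1, invmx M 0 1 = (\det M)^-1 * - M 0 1,
      invmx M 1 0 = (\det M)^-1 * - M 1 0 & invmx M 1 1 = (\det M)^-1 * M 0 0].
Proof.
move=> d0; have uM : M \in unitmx by rewrite unitmxE unitfE.
pose N : 'M[R]_2 := \matrix_(i, j) ((\det M)^-1 *
  (if i == 0 then if j == 0 then M 1 1 else - M 0 1
   else if j == 0 then - M 1 0 else M 0 0)).
suff -> : invmx M = N by rewrite /N !mxE.
suff MN : M *m N = 1%:M by rewrite -[RHS]mul1mx -(mulVmx uM) -mulmxA MN mulmx1.
rewrite det_mx2 in d0.
apply/matrixP; apply: forall_I2; apply: forall_I2;
  rewrite mxE sum_I2 /N !mxE /= det_mx2 ?mulr1n ?mulr0n; field; exact: d0.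
Qed.

Lemma lagrange u v :
  dot (cross u v) (cross u v) = dot u u * dot v v - dot u v * dot v u.
Proof. by rewrite !dot3E !crossE; ring. Qed.

Lemma dot_eq0 u : dot u u = 0 -> u = 0.
Proof.
rewrite dot3E -!expr2 => h.
have := sqr_ge0 (u 0 0); have := sqr_ge0 (u 0 1); have := sqr_ge0 (u 0 2) => h2 h1 h0.
apply: row3P; rewrite entry0; apply/eqP; rewrite -sqrf_eq0; apply/eqP; lra.
Qed.

Lemma cross_triple u v : cross (cross u v) u = dot u u *: v - dot u v *: u.
Proof. by apply: row3P; rewrite !dot3E !entryE; ring. Qed.

Lemma dotC u v : dot u v = dot v u.
Proof. by rewrite !dot3E; ring. Qed.

Lemma dot_ge0 u : 0 <= dot u u.
Proof. by rewrite dot3E -!expr2 !addr_ge0 ?sqr_ge0. Qed.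

End Algebra.

(** * Mean curvature as curvature of the connection *)

Section Geometry.
Variables (R : realType) (Omega : set 'rV[R]_2) (f : 'rV[R]_2 -> 'rV[R]_3).
Hypotheses (oO : open Omega) (hf : immersion Omega f).

(* Abstracting the partial derivatives keeps them from being unfolded. *)
Variables f0 f1 : 'rV[R]_2 -> 'rV[R]_3.
Hypotheses (f0E : partial 0 f = f0) (f1E : partial 1 f = f1).

Let E z := dot (f0 z) (f0 z).
Let F z := dot (f0 z) (f1 z).
Let G z := dot (f1 z) (f1 z).
Let D z := E z * G z - F z * F z.
(** With D = EG - F^2, J d_0 = (E d_1 - F d_0) / sqrt D and J d_1 = (F d_1 - G d_0) / sqrt D; hence
    [alpha] and [beta] are 2 df(J d_0) and 2 df(J d_1). *)
Let alpha z := (2 * (Num.sqrt (D z))^-1) *: (E z *: f1 z - F z *: f0 z).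
Let beta z := (2 * (Num.sqrt (D z))^-1) *: (F z *: f1 z - G z *: f0 z).

Let df z : Omega z -> differentiable f z.
Proof. by case: hf => -[h _] _; exact: h. Qed.

Let df0 : of_class 1 Omega f0.
Proof. by case: hf => -[_ h] _; rewrite -f0E; exact: h. Qed.

Let df1 : of_class 1 Omega f1.
Proof. by case: hf => -[_ h] _; rewrite -f1E; exact: h. Qed.

Let D_normal z : D z = dot (cross (f0 z) (f1 z)) (cross (f0 z) (f1 z)).
Proof. by rewrite lagrange (dotC (f1 z)). Qed.

(** If f0 x f1 = 0, then (f0 x f1) x f0 = E f1 - F f0 vanishes, so df kills (-F, E). Injectivity
    gives E = 0, hence f0 = 0, and then df kills d_0, a contradiction. *)
Let D_gt0 z : Omega z -> 0 < D z.
Proof.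
move=> Oz; rewrite lt_neqAle D_normal dot_ge0 andbT eq_sym; apply/eqP => /dot_eq0 n0.
have inj := hf.2 z Oz; have d0 : 'd f z 0 = 0 by exact: linear0.
have dE w : 'd f z w = lin2 (f0 z) (f1 z) w by rewrite -f0E -f1E; exact: diffE_partial (df Oz).
have := cross_triple (f0 z) (f1 z); rewrite n0 cross0l => /esym h.
pose w : 'rV[R]_2 := \row_j (if j == 0 then - F z else E z).
have w0 : w = 0.
  apply: inj; rewrite d0 dE /lin2 !mxE/= addrC scaleNr; exact: h.
have E0 : E z = 0 by have := congr1 (fun u : 'rV[R]_2 => u 0 1) w0; rewrite !mxE.
have : delta_mx 0 0 = 0 :> 'rV[R]_2.
  by apply: inj; rewrite d0 dE lin2_delta0; exact: dot_eq0.
move=> /(congr1 (fun u : 'rV[R]_2 => u 0 0)) /eqP.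
by rewrite !mxE/= oner_eq0.
Qed.

Let metricE z : [/\ metric f z 0 0 = E z, metric f z 0 1 = F z,
  metric f z 1 0 = F z & metric f z 1 1 = G z].
Proof. by rewrite /F {2}dotC /E /G -f0E -f1E; split; rewrite mxE. Qed.

Let det_metric z : \det (metric f z) = D z.
Proof. by have [m00 m01 m10 m11] := metricE z; rewrite det_mx2 m00 m01 m10 m11. Qed.

Let areaE z : area_density f z = Num.sqrt (D z).
Proof. by rewrite /area_density det_metric. Qed.

Let scalarC1_dot u v : of_class 1 Omega u -> of_class 1 Omega v ->
  scalarC1 Omega (fun z => dot (u z) (v z)).
Proof.
move=> Cu Cv; under eq_fun do rewrite dot3E.
by apply: (scalarC1D oO); first apply: (scalarC1D oO);
  apply: (scalarC1M oO); exact: scalarC1_entry.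
Qed.

Let CD : scalarC1 Omega D.
Proof.
by apply: (scalarC1B oO); apply: (scalarC1M oO); exact: scalarC1_dot.
Qed.

Let C1_combination (g h : 'rV[R]_2 -> R) : scalarC1 Omega g -> scalarC1 Omega h ->
  of_class 1 Omega
    (fun z => (2 * (Num.sqrt (D z))^-1) *: (g z *: f1 z - h z *: f0 z)).
Proof.
move=> Cg Ch; apply: (of_class1_entries oO) => k.
under eq_fun do rewrite entryZ entryD entryN !entryZ.
apply: (scalarC1M oO).
  apply: (scalarC1M oO); first exact: scalarC1_cst.
  exact: (scalarC1_invsqrt oO CD D_gt0).
exact: (scalarC1B oO (scalarC1M oO Cg (scalarC1_entry oO k df1))
  (scalarC1M oO Ch (scalarC1_entry oO k df0))).
Qed.

Let Calpha : of_class 1 Omega alpha.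
Proof. by apply: C1_combination; exact: scalarC1_dot. Qed.

Let Cbeta : of_class 1 Omega beta.
Proof. by apply: C1_combination; exact: scalarC1_dot. Qed.

Let complex_structureE z v : Omega z ->
  2 *: 'd f z (complex_structure f z v) = lin2 (alpha z) (beta z) v.
Proof.
move=> Oz; have -> := diffE_partial (complex_structure f z v) (df Oz).
rewrite f0E f1E; have [m00 m01 m10 m11] := metricE z.
have m0 : (v *m metric f z) 0 0 = v 0 0 * E z + v 0 1 * F z.
  by rewrite mxE sum_I2 m00 m10.
have m1 : (v *m metric f z) 0 1 = v 0 0 * F z + v 0 1 * G z.
  by rewrite mxE sum_I2 m01 m11.
have c0 : complex_structure f z v 0 0 =
    (Num.sqrt (D z))^-1 * - (v 0 0 * F z + v 0 1 * G z).
  by rewrite -m1 /complex_structure areaE mxE mxE.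
have c1 : complex_structure f z v 0 1 =
    (Num.sqrt (D z))^-1 * (v 0 0 * E z + v 0 1 * F z).
  by rewrite -m0 /complex_structure areaE mxE mxE.
rewrite /lin2 c0 c1 /alpha /beta.
move: (f0 z) (f1 z) (E z) (F z) (G z) (Num.sqrt (D z))^-1 => u w e h g s.
by apply/rowP => i; rewrite !entryE; ring.
Qed.

Let parallel_sectionE eps :
  parallel_section f Omega eps <-> parallel alpha beta Omega eps.
Proof.
by split=> pe z Oz; have [de deE] := pe z Oz; split=> // v;
  [rewrite -complex_structureE// crossZr; exact: deE|
   rewrite -crossZr complex_structureE//; exact: deE].
Qed.

(** J preserves oriented area, and each of the two forms carries a factor 2. *)
Let cross_alpha_beta z : Omega z -> cross (alpha z) (beta z) = 4 *: cross (f0 z) (f1 z).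
Proof.
move=> Oz; have D0 := D_gt0 Oz.
have sD : (Num.sqrt (D z))^-1 * (Num.sqrt (D z))^-1 * D z = 1.
  by rewrite -invfM -expr2 sqr_sqrtr ?ltW// mulVf// gt_eqF.
rewrite /alpha /beta; move: sD; rewrite {3}/D.
move: (f0 z) (f1 z) (E z) (F z) (G z) (Num.sqrt (D z))^-1 => u w e h g s sD.
transitivity ((4 * (s * s * (e * g - h * h))) *: cross u w); last by rewrite sD mulr1.
by apply: row3P; rewrite !entryE; ring.
Qed.

(** The field whose divergence is taken in [laplace f f]. By [fluxE] it is a quarter-turn of df,
    with components -beta / 2 and alpha / 2, so this divergence becomes half of d_1 alpha - d_0
    beta. *)
Let flux i q := \sum_j (area_density f q * invmx (metric f q) i j) *: partial j f q.

Let fluxE q : Omega q -> flux 0 q = (- 2^-1) *: beta q /\ flux 1 q = 2^-1 *: alpha q.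
Proof.
move=> Oq; have D0 := D_gt0 Oq; have d0 : \det (metric f q) != 0.
  by rewrite det_metric gt_eqF.
have [i00 i01 i10 i11] := invmx2 d0.
have sD : Num.sqrt (D q) * (D q)^-1 = (Num.sqrt (D q))^-1.
  have s0 : Num.sqrt (D q) != 0 by rewrite gt_eqF// sqrtr_gt0.
  by rewrite -{2}(sqr_sqrtr (ltW D0)) expr2 invfM mulrA divff// mul1r.
rewrite /flux !sum_I2 i00 i01 i10 i11 areaE det_metric !mulrA sD.
have [-> -> -> ->] := metricE q; rewrite f0E f1E /alpha /beta.
move: (f0 q) (f1 q) (E q) (F q) (G q) (Num.sqrt (D q))^-1 => u w e h g s.
by split; apply/rowP => i; rewrite !entryE; field.
Qed.

Let laplaceE p : Omega p -> laplace f f p =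
  (Num.sqrt (D p))^-1 *: (2^-1 *: (partial 1 alpha p - partial 0 beta p)).
Proof.
move=> Op; rewrite /laplace areaE; congr (_ *: _).
rewrite sum_I2.
have nO : \forall z \near p, Omega z by apply: open_nbhs_nbhs.
have -> : partial 0 (flux 0) p = partial 0 (fun q => (- 2^-1) *: beta q) p.
  by apply: near_eq_derive; apply: filterS nO => q /fluxE[].
have -> : partial 1 (flux 1) p = partial 1 (fun q => 2^-1 *: alpha q) p.
  by apply: near_eq_derive; apply: filterS nO => q /fluxE[].
have [da _] := Calpha; have [db _] := Cbeta.
have -> : partial 1 (fun q => 2^-1 *: alpha q) p = 2^-1 *: partial 1 alpha p.
  by apply: deriveZ; exact/diff_derivable/da.
have -> : partial 0 (fun q => (- 2^-1) *: beta q) p = (- 2^-1) *: partial 0 beta p.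
  by apply: deriveZ; exact/diff_derivable/db.
by rewrite scaleNr addrC -scalerBr.
Qed.

Let unit_normalE p : unit_normal f p = (Num.sqrt (D p))^-1 *: cross (f0 p) (f1 p).
Proof. by rewrite /unit_normal f0E f1E -D_normal. Qed.

(** After cancelling 1 / sqrt D, the equation for H = 1 is (d_1 alpha - d_0 beta) / 2 = 2 f0 x f1,
    and 4 f0 x f1 is alpha x beta. *)
Let mean_curvature_iff :
  has_mean_curvature f Omega (fun=> 1) <-> curvature_free Omega alpha beta.
Proof.
have s0 p : Omega p -> (Num.sqrt (D p))^-1 != 0.
  by move=> Op; rewrite invr_eq0 gt_eqF// sqrtr_gt0 D_gt0.
split=> h p Op; last first.
  rewrite laplaceE// unit_normalE (h p Op) cross_alpha_beta// !scalerA.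
  by congr (_ *: _); move: (Num.sqrt _)^-1 => s; field.
have e := h p Op; rewrite laplaceE// unit_normalE mulr1 in e.
have {}e : (Num.sqrt (D p))^-1 *: (2^-1 *: (partial 1 alpha p - partial 0 beta p)) =
    (Num.sqrt (D p))^-1 *: (2 *: cross (f0 p) (f1 p)).
  by rewrite e !scalerA mulrC.
have {}e := scalerI (s0 p Op) e.
rewrite cross_alpha_beta// (_ : 4 = 2 * 2 :> R); last by ring.
by rewrite -scalerA -e scalerA divff ?scale1r.
Qed.

Lemma mean_curvature_one_iff_flat :
  connected Omega -> loops_contractible Omega ->
  has_mean_curvature f Omega (fun=> 1) <-> spinning_sphere_flat f Omega.
Proof.
move=> cO lc; rewrite mean_curvature_iff (flat_iff_parallel oO Calpha Cbeta cO lc).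
split=> h p Op e; have [eps [pe epsp]] := h p Op e; exists eps; split=> //.
  exact/parallel_sectionE.
exact/parallel_sectionE.
Qed.

End Geometry.

Theorem proposition13 (R : realType) (Omega : set 'rV[R]_2)
    (f : 'rV[R]_2 -> 'rV[R]_3)
    (hOmega : simply_connected_domain Omega)
    (hf : immersion Omega f) :
  has_mean_curvature f Omega (fun _ => 1) <-> spinning_sphere_flat f Omega.
Proof.
have [[oO cO _] lc] := hOmega.
exact: mean_curvature_one_iff_flat oO hf _ _ erefl erefl cO lc.
Qed.
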